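(* Assume all nonzero roots of $P$ lie in $U=\{z: q<|z|<q^{-1}\}$. Let $w$ be a nonzero meromorphic function with $w(x+1)=w(x)$, $w(x+\tau)=tw(x)$, such that $w(x+\frac\tau2)P(e^{2\pi i x})$ is holomorphic on the closed parallelogram with vertices $-\frac\tau2,\frac\tau2,1+\frac\tau2,1-\frac\tau2$ and $w$ is holomorphic on $\mathbb{R}$, and let $T$ be the $g_t$-twisted trace on $\mathcal{A}$ vanishing on $\mathcal{A}_i$, $i\neq 0$, with $T(R(Z))=\int_0^1R(e^{2\pi i x})w(x)\,dx$. Then $T$ is positive if and only if both $w(x)$ and $e^{-\pi i c}P(e^{2\pi i x})\,w(x+\frac\tau2)$ are nonnegative for all $x\in[0,1]$.
   Context: Let $0<q<1$ and $\tau\in i\mathbb{R}_{>0}$ with $q=e^{\pi i\tau}$. Let $P$ be a Laurent polynomial with $n>0$ nonzero roots which is real-valued on $S^1$. $\mathcal{A}=\mathcal{A}_P$ is generated by $u,v,Z,Z^{-1}$ with relations $ZZ^{-1}=Z^{-1}Z=1$, $ZuZ^{-1}=q^2u$, $ZvZ^{-1}=q^{-2}v$, $uv=P(q^{-1}Z)$, $vu=P(qZ)$; $\mathcal{A}_i=\{a: ZaZ^{-1}=q^{2i}a\}$, $\mathcal{A}_0=\mathbb{C}[Z,Z^{-1}]$. Let $t=e^{2\pi i c}$ with $c\in[0,1)$; $g_t(u)=tu$, $g_t(v)=t^{-1}v$, $g_t(Z)=Z$; a $g_t$-twisted trace is linear $T$ with $T(ab)=T(bg_t(a))$. $\rho$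 is the antilinear automorphism with $\rho(u)=e^{-\pi i c}v$, $\rho(v)=e^{\pi i c}u$, $\rho(Z)=Z^{-1}$. A $g_t$-twisted trace $T$ is positive if $(a,b)_T=T(a\rho(b))$ is positive definite. *)

(* Defs.v *)
From HB Require Import structures.
From mathcomp Require Import all_boot all_order all_algebra.
From mathcomp Require Import all_classical all_reals all_analysis.
From mathcomp Require Export complex.
Set Implicit Arguments. Unset Strict Implicit. Unset Printing Implicit Defensive.
Import Order.TTheory GRing.Theory Num.Theory.
Import numFieldNormedType.Exports.
Local Open Scope ring_scope.
Local Open Scope complex_scope.

Definition cexp {R : realType} (z : R[i]) : R[i] :=
  (expR (complex.Re z))%:C * (cos (complex.Im z) +i* sin (complex.Im z)).

Definition iC {R : realType} : R[i] := 0 +i* 1.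

Definition Zpow {A : nzRingType} (Z Zi : A) (k : int) : A :=
  match k with Posz n => Z ^+ n | Negz n => Zi ^+ n.+1 end.

(* A Laurent polynomial P is represented by (p, m) : P(z) = z^m p(z). *)
Definition laurC {R : realType} (p : {poly R[i]}) (m : int) (z : R[i]) : R[i] :=
  z ^ m * p.[z].

Definition laurA {R : realType} {A : algType R[i]} (Z Zi : A)
  (p : {poly R[i]}) (m : int) (al : R[i]) : A :=
  \sum_(k < size p) (p`_k * al ^ (k%:Z + m)) *: Zpow Z Zi (k%:Z + m).

Definition AP_rel {R : realType} {A : algType R[i]} (q : R)
  (p : {poly R[i]}) (m : int) (u v Z Zi : A) : Prop :=
  [/\ Z * Zi = 1, Zi * Z = 1,
      Z * u * Zi = (q%:C ^+ 2) *: u, Z * v * Zi = (q%:C ^- 2) *: v &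
      u * v = laurA Z Zi p m (q%:C)^-1 /\ v * u = laurA Z Zi p m q%:C].

(* (A, u, v, Z, Zi) is the algebra presented by generators u, v, Z, Z^{-1}
   and the relations above (universal property). *)
Definition is_AP {R : realType} (A : algType R[i]) (q : R)
  (p : {poly R[i]}) (m : int) (u v Z Zi : A) : Prop :=
  AP_rel q p m u v Z Zi /\
  forall (B : algType R[i]) (u' v' Z' Zi' : B), AP_rel q p m u' v' Z' Zi' ->
    exists f : {lrmorphism A -> B},
      [/\ f u = u', f v = v', f Z = Z', f Zi = Zi' &
        forall g : {lrmorphism A -> B},
          g u = u' -> g v = v' -> g Z = Z' -> g Zi = Zi' -> forall a, g a = f a].

Definition in_Ai {R : realType} {A : algType R[i]} (q : R) (Z Zi : A)
  (i : int) (a : A) : Prop :=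
  Z * a * Zi = (q%:C ^ (2 * i)) *: a.

Definition twisted_trace {R : realType} {A : algType R[i]} (g : A -> A)
  (T : A -> R[i]) : Prop :=
  (forall (k : R[i]) (a b : A), T (k *: a + b) = k * T a + T b) /\
  (forall a b : A, T (a * b) = T (b * g a)).

Definition positive_trace {R : realType} {A : algType R[i]} (rho : A -> A)
  (T : A -> R[i]) : Prop :=
  forall a : A, a != 0 -> 0 < T (a * rho a).

Definition cint01 {R : realType} (f : R -> R[i]) : R[i] :=
  (Rintegral (@lebesgue_measure R) `[0, 1]%classic (fun x => complex.Re (f x)))%:C
  + iC * (Rintegral (@lebesgue_measure R) `[0, 1]%classic (fun x => complex.Im (f x)))%:C.

Definition holo_at {R : realType} (f : R[i] -> R[i]) (z : R[i]) : Prop :=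
  derivable (f : (R[i])^o -> (R[i])^o) z 1.

(* w is a meromorphic function on C whose singular set is contained in S:
   S is closed and discrete, w is holomorphic off S, and each point of S
   is at worst a pole. *)
Definition meromorphic {R : realType} (w : R[i] -> R[i]) (S : set R[i]) : Prop :=
  [/\ (forall z, exists e : R, 0 < e /\
         forall y, `|y - z| < e%:C -> y != z -> ~ S y),
      (forall z, ~ S z -> holo_at w z) &
      (forall a, S a -> exists (k : nat) (e : R) (g : R[i] -> R[i]), 0 < e /\
         (forall y, `|y - a| < e%:C -> holo_at g y) /\
         (forall y, `|y - a| < e%:C -> y != a -> g y = (y - a) ^+ k * w y))].

Definition parallelogram {R : realType} (tau : R[i]) : set R[i] :=
  fun z => exists x y : R, [/\ 0 <= x <= 1, - (1/2) <= y <= 1/2 &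
                              z = x%:C + y%:C * tau].

(* Main.v *)
Require Import Defs.
From HB Require Import structures.
From mathcomp Require Import all_boot all_order all_algebra.
From mathcomp Require Import all_classical all_reals all_analysis.
From mathcomp Require Import complex.
From mathcomp Require Import ring lra zify.
Import Order.TTheory GRing.Theory Num.Theory.
Import numFieldNormedType.Exports.
Local Open Scope ring_scope.
Local Open Scope complex_scope.
Local Open Scope classical_set_scope.

(* Write N(a) = T(a rho(a)). Since rho preserves products and exchanges the
   degrees i and -i, the form splits over the degrees, and the twisted trace
   property gives N(bu) = N(vb) and N(bv) = N(ub), so that everything reduces to
   the degrees 0 and 1. There N(R(Z)) is the integral of |R|^2 w over the circle,
   and N(R(Z)u) becomes the integral of |R(qz)|^2 e^{-pi i c} P(z) w(x + tau/2)
   when the contour is moved by tau/2. Peaked kernels of the form |R|^2 show that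
   these integrals are nonnegative for all R exactly when the two weights are
   nonnegative. Strictness needs that no weight vanishes identically: otherwise
   the Fourier coefficients of w(x + tau/2) P vanish on a line, hence by moving
   the contour on every line of the strip, and w would be zero. *)

(** * Integrals of continuous functions on a segment *)

(** The algebra is known only through its universal property, so no basis is at hand: neither the
    independence of the powers of Z nor the cancellation of factors P(q^k Z) can be read off. The
    form itself supplies both. If an element R(Z) vanishes, so does the integral of |R|^2 w, hence R
    vanishes on an arc where w is nonzero; conversely, enough zeros of R on an arc force R(Z) = 0.
    The roots enter here: passing between degrees produces factors P(q^k Z) with k odd, and since
    all roots satisfy q < |z| < 1/q these factors have no zero on the unit circle. The shift by
    tau/2 comes from the geometry of the strip: its lower edge is sent by e^{2 pi i x} to |z| = 1/q,
    where the extension h of w(x + tau/2) P equals w times the factor P(q^{-1}Z) of uv. The values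
    of w on its singular set S are unconstrained, so identities are proved at z + d for small d > 0
    and then passed to the limit. *)

Section RealIntegral.
Context {R : realType}.
Implicit Types (f g : R -> R) (a b k : R).

Definition rint a b f := Rintegral (@lebesgue_measure R) `[a, b]%classic f.

Definition cseg a b f := forall x, a <= x <= b -> {for x, continuous f}.

Lemma cseg_within a b f : cseg a b f -> {within `[a, b], continuous f}.
Proof.
move=> fc; apply: continuous_in_subspaceT => x /set_mem/=.
by rewrite in_itv/= => /fc.
Qed.

Lemma cseg_integrable {a b f} : cseg a b f ->
  (@lebesgue_measure R).-integrable `[a, b] (EFin \o f).
Proof.
move=> fc; apply: continuous_compact_integrable; first exact: segment_compact.
exact: cseg_within.
Qed.

Lemma csegS a b c d f : a <= c -> d <= b -> cseg a b f -> cseg c d f.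
Proof. by move=> ac db fc x /andP[cx xd]; apply: fc; lra. Qed.

Lemma eq_rint a b f g : (forall x, a <= x <= b -> f x = g x) ->
  rint a b f = rint a b g.
Proof.
by move=> fg; apply: eq_Rintegral => x /set_mem/=; rewrite in_itv/= => /fg.
Qed.

Lemma rintD a b f g : cseg a b f -> cseg a b g ->
  rint a b (fun x => f x + g x) = rint a b f + rint a b g.
Proof.
by move=> fc gc; apply: RintegralD => //; exact: cseg_integrable.
Qed.

Lemma rintZ a b k f : cseg a b f ->
  rint a b (fun x => k * f x) = k * rint a b f.
Proof. by move=> fc; apply: RintegralZl => //; exact: cseg_integrable. Qed.

Lemma le_rint a b f g : cseg a b f -> cseg a b g ->
  (forall x, a <= x <= b -> f x <= g x) -> rint a b f <= rint a b g.
Proof.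
move=> fc gc fg; apply: le_Rintegral => //; try exact: cseg_integrable.
Qed.

Lemma rint_cst a b k : a <= b -> rint a b (fun=> k) = k * (b - a).
Proof.
move=> ab; rewrite /rint Rintegral_cst//= lebesgue_measure_itv/= lte_fin.
by case: ltP => //= ba; have -> : a = b by [lra]; rewrite subrr.
Qed.

Lemma rint_cat a c b f : a <= c -> c <= b -> cseg a b f ->
  rint a b f = rint a c f + rint c b f.
Proof.
move=> ac cb fc; have fi := cseg_integrable fc.
have := @Rintegral_itvB R f (BLeft a) (BRight b) c fi.
rewrite !bnd_simp => /(_ ac cb) /eqP; rewrite subr_eq => /eqP.
rewrite /rint => ->; rewrite addrC; congr (_ + _).
rewrite Rintegral_itv_obnd_cbnd//.
by apply: integrableS fi => //; apply: subset_itv; rewrite bnd_simp.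
Qed.

Lemma rint_norm a b f k : a <= b -> cseg a b f ->
  (forall x, a <= x <= b -> `|f x| <= k) -> `|rint a b f| <= k * (b - a).
Proof.
move=> ab fc fk.
have cc c : cseg a b (fun=> c) by move=> x _; exact: cst_continuous.
rewrite ler_norml -mulNr -!rint_cst//.
by rewrite !le_rint// => x /fk; rewrite ler_norml => /andP[].
Qed.

Lemma cseg_bounded a b f : a <= b -> cseg a b f ->
  exists2 k, 0 < k & forall x, a <= x <= b -> `|f x| <= k.
Proof.
move=> ab fc; have nc : cseg a b (fun x => `|f x|).
  by move=> x /fc fx; apply: (continuous_comp fx); exact: norm_continuous.
have [c _ cm] := EVT_max ab (cseg_within _ _ _ nc).
exists (`|f c| + 1) => [|x xab]; first by rewrite ltr_wpDl.
by rewrite (le_trans (cm x _)) ?in_itv// lerDl.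
Qed.

(* cos^2 (pi (x - y)), in a form which is visibly [`|1 + e(x - y)|^2 / 4]. *)
Definition peak (y x : R) := (1 + cos (2 * pi * (x - y))) / 2.

Lemma peak_ge0 y x : 0 <= peak y x.
Proof. by rewrite /peak; have := cos_geN1 (2 * pi * (x - y)); lra. Qed.

Lemma peak_continuous y n : continuous (fun x => peak y x ^+ n).
Proof.
move=> x; apply: (continuous_comp _ (@exprn_continuous _ n _)).
rewrite /peak; apply: cvgM; last exact: cvg_cst.
apply: cvgD; first exact: cvg_cst.
apply: (@continuous_comp _ _ _ (fun t => 2 * pi * (t - y)) (@cos R));
  last exact: continuous_cos.
by apply: cvgM; [exact: cvg_cst|apply: cvgB; [exact: cvg_id|exact: cvg_cst]].
Qed.

Lemma le_cos (x y : R) : 0 <= x -> x <= y -> y <= pi -> cos y <= cos x.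
Proof.
move=> x0; rewrite le_eqVlt => /predU1P[->//|xy] ypi.
by apply/ltW; rewrite ltr_cos// in_itv/=; lra.
Qed.

Lemma exists_expr_lt (r e : R) : 0 <= r < 1 -> 0 < e -> exists n, r ^+ n < e.
Proof.
move=> /andP[r0 r1] e0.
have /cvgr0Pnorm_lt/(_ _ e0) : r ^+ n @[n --> \oo] --> 0.
  by apply: cvg_expr; rewrite ger0_norm.
case=> N _ /(_ N (leqnn N)) /=.
by rewrite ger0_norm ?exprn_ge0//; exists N.
Qed.

(** If f is negative at a point, it is bounded away from 0 on a short interval around some y. High
    powers of the peak at y weigh that interval by at least A^N and everything at distance more than
    r by at most B^N, with B < A, so the integral becomes negative. *)
Lemma peak_kernel_ge0 f : cseg 0 1 f ->
  (forall n y, 0 <= rint 0 1 (fun x => peak y x ^+ n * f x)) ->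
  forall x, 0 <= x <= 1 -> 0 <= f x.
Proof.
move=> fc kf x0 x01; rewrite leNgt; apply/negP => fx0.
have [d d0 fd] : exists2 d, 0 < d &
    forall y, `|y - x0| < d -> f y < f x0 / 2.
  have /cvgr_lt/(_ (f x0 / 2)) := fc _ x01.
  have h : f x0 < f x0 / 2 by lra.
  move=> /(_ h) [d /= d0 fd]; exists d => // y yx.
  by apply: fd; rewrite /= distrC.
pose r := Num.min d 1 / 4.
have r0 : 0 < r by rewrite divr_gt0// lt_min d0 ltr01.
have [rd r1] : 4 * r <= d /\ 4 * r <= 1.
  have -> : 4 * r = Num.min d 1 by rewrite /r; lra.
  by rewrite !ge_min !lexx orbT.
(* The centre is moved inwards by r, so that a full interval of radius r fits into [0, 1] even when
   x0 is an endpoint; f need not be periodic. *)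
pose y := if x0 <= 1 / 2 then x0 + r else x0 - r.
have [y0 y1 yx0] : [/\ 0 <= y - r, y + r <= 1 &
    forall x, `|x - y| <= r -> f x < f x0 / 2].
  rewrite /y; have [h|h] := leP x0 (1/2); (split; [lra|lra|]) => x.
    by rewrite ler_norml => hx; apply: fd; rewrite ltr_norml; lra.
  by rewrite ler_norml => hx; apply: fd; rewrite ltr_norml; lra.
have [M M0 fM] := cseg_bounded 0 1 f ler01 fc.
have pi0 := pi_gt0 R.
pose A := (1 + cos (pi * r)) / 2; pose B := (1 + cos (2 * pi * r)) / 2.
have B0 : 0 <= B by have := cos_geN1 (2 * pi * r); rewrite /B; lra.
have BA : B < A.
  suff : cos (2 * pi * r) < cos (pi * r) by rewrite /A /B; lra.
  by rewrite ltr_cos ?in_itv/=; nra.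
have pA x : `|x - y| <= r / 2 -> A <= peak y x.
  move=> xy; rewrite /peak /A.
  suff : cos (pi * r) <= cos (2 * pi * (x - y)) by lra.
  rewrite -[leRHS]cos_norm; apply: le_cos; rewrite ?normr_ge0//; last nra.
  by rewrite normrM gtr0_norm; nra.
have pB x : 0 <= x <= 1 -> r < `|x - y| -> peak y x <= B.
  move=> x1 xy; rewrite /peak /B.
  suff : cos (2 * pi * (x - y)) <= cos (2 * pi * r) by lra.
  rewrite -cos_norm normrM gtr0_norm; last by nra.
  (* The peak has period 1, so x must also stay at distance r from y - 1 and y + 1. *)
  have xy1 : `|x - y| <= 1 - r by rewrite ler_norml; lra.
  have [h|h] := leP `|x - y| (1/2).
    by apply: le_cos; nra.
  have -> : cos (2 * pi * `|x - y|) = cos (2 * pi * (1 - `|x - y|)).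
    rewrite -[RHS]cosN -[RHS](cosD2pi); congr cos.
    by rewrite mulr2n; ring.
  by apply: le_cos; nra.
have A0 : 0 < A by lra.
(* This N makes M B^N smaller than (- f x0 / 2) A^N r, so the inner interval outweighs the two
   sides. *)
have [||N] := exists_expr_lt (B / A) (- f x0 / 2 * r / M).
- by rewrite divr_ge0 ?(ltW A0)//= ltr_pdivrMr ?mul1r.
- by rewrite divr_gt0// mulr_gt0//; lra.
rewrite ltr_pdivlMr// expr_div_n mulrAC ltr_pdivrMr ?exprn_gt0//.
move=> hN.
have := kf N y; rewrite leNgt => /negP; apply.
have gc : cseg 0 1 (fun x => peak y x ^+ N * f x).
  by move=> x /fc fx; apply: continuousM => //; exact: peak_continuous.
have cc a b k : cseg a b (fun=> k) by move=> x _; exact: cst_continuous.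
rewrite (rint_cat 0 (y - r / 2) 1)//; try lra.
rewrite (rint_cat (y - r / 2) (y + r / 2) 1)//; try lra; last first.
  by apply: csegS gc; lra.
(* Between r/2 and r the integrand is nonpositive because f is negative there; beyond r the bounds
   B^N and M apply. *)
have side a b : 0 <= a -> b <= 1 -> a <= b ->
    (forall x, a <= x <= b -> r / 2 <= `|x - y|) ->
    rint a b (fun x => peak y x ^+ N * f x) <= M * B ^+ N * (b - a).
  move=> a0 b1 ab xab; rewrite -rint_cst//; apply: le_rint => //.
    by apply: csegS gc; lra.
  move=> x hx; have [h|h] := leP `|x - y| r.
    rewrite (@le_trans _ _ 0)//; last by rewrite mulr_ge0 ?exprn_ge0// ltW.
    rewrite mulr_ge0_le0 ?exprn_ge0 ?peak_ge0//.
    by have := yx0 _ h; lra.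
  have x1 : 0 <= x <= 1 by lra.
  rewrite (@le_trans _ _ (peak y x ^+ N * M))//.
    rewrite ler_wpM2l ?exprn_ge0 ?peak_ge0//.
    by rewrite (le_trans (ler_norm _))// fM.
  rewrite mulrC ler_wpM2l//; first exact: ltW.
  by rewrite lerXn2r// ?nnegrE ?peak_ge0// pB.
have s3 : rint (y - r / 2) (y + r / 2) (fun x => peak y x ^+ N * f x)
    <= f x0 / 2 * A ^+ N * r.
  have -> : f x0 / 2 * A ^+ N * r =
    f x0 / 2 * A ^+ N * ((y + r / 2) - (y - r / 2)) by field.
  rewrite -rint_cst; last lra.
  apply: le_rint => //; first by apply: csegS gc; lra.
  move=> x hx; have xy : `|x - y| <= r / 2 by rewrite ler_norml; lra.
  have xr : `|x - y| <= r by lra.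
  have := yx0 _ xr => fx; have := pA _ xy => px.
  rewrite (@le_trans _ _ (peak y x ^+ N * (f x0 / 2)))//.
    by rewrite ler_wpM2l ?exprn_ge0 ?peak_ge0// ltW.
  rewrite mulrC ler_wnM2l//; first lra.
  by rewrite lerXn2r// ?nnegrE ?peak_ge0//; lra.
have s1 : rint 0 (y - r / 2) (fun x => peak y x ^+ N * f x)
   <= M * B ^+ N * (y - r / 2 - 0).
  apply: side; [lra|lra|lra|move=> x hx].
  by rewrite distrC ger0_norm; lra.
have s2 : rint (y + r / 2) 1 (fun x => peak y x ^+ N * f x)
   <= M * B ^+ N * (1 - (y + r / 2)).
  apply: side; [lra|lra|lra|move=> x hx].
  by rewrite ger0_norm; lra.
have MB : 0 <= M * B ^+ N by rewrite mulr_ge0 ?exprn_ge0// ltW.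
nra.
Qed.

End RealIntegral.


(** * The modulus, complex differentiability and the exponential *)

(** The modulus as an element of [R]; the norm [|z|] lives in [R[i]], out of reach of real
    arithmetic tactics. *)
Definition nr {R : realType} (z : R[i]) : R := ComplexField.Normc.normc z.
Arguments nr : simpl never.

Section ComplexNorm.
Context {R : realType}.
Implicit Types (z : R[i]).

Lemma nrE z : `|z| = (nr z)%:C. Proof. by []. Qed.

Lemma nr_ge0 z : 0 <= nr z.
Proof. by case: z => a b; exact: sqrtr_ge0. Qed.

Lemma nrM z1 z2 : nr (z1 * z2) = nr z1 * nr z2.
Proof. exact: ComplexField.Normc.normcM. Qed.

Lemma nrD z1 z2 : nr (z1 + z2) <= nr z1 + nr z2.
Proof. exact: le_normcD. Qed.

Lemma nrN z : nr (- z) = nr z.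
Proof. exact: normcN. Qed.

Lemma nrB z1 z2 : nr (z1 - z2) = nr (z2 - z1).
Proof. by rewrite -nrN opprB. Qed.

Lemma nr0 : nr (0 : R[i]) = 0. Proof. exact: ComplexField.Normc.normc0. Qed.

Lemma nr1 : nr (1 : R[i]) = 1. Proof. exact: ComplexField.Normc.normc1. Qed.

Lemma nr_eq0 z : (nr z == 0) = (z == 0).
Proof.
by apply/eqP/eqP => [/ComplexField.Normc.eq0_normc|->] //; rewrite nr0.
Qed.

Lemma nr_real (x : R) : nr x%:C = `|x|.
Proof. by rewrite /nr /= expr0n/= addr0 sqrtr_sqr. Qed.

Lemma nr_i : nr (iC : R[i]) = 1.
Proof. by rewrite /nr /iC /= expr0n/= add0r expr1n sqrtr1. Qed.

Lemma Re_le_nr z : `|complex.Re z| <= nr z.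
Proof.
case: z => a b; rewrite /nr /= -sqrtr_sqr ler_wsqrtr// lerDl sqr_ge0//.
Qed.

Lemma Im_le_nr z : `|complex.Im z| <= nr z.
Proof.
case: z => a b; rewrite /nr /= -sqrtr_sqr ler_wsqrtr// lerDr sqr_ge0//.
Qed.

Lemma complex_iC z : z = (complex.Re z)%:C + iC * (complex.Im z)%:C.
Proof. exact: complexE. Qed.

Lemma nr_le z : nr z <= `|complex.Re z| + `|complex.Im z|.
Proof.
rewrite {1}[z]complex_iC (le_trans (nrD _ _))// nrM nr_i !nr_real mul1r//.
Qed.

Lemma eq0_small z : (forall e : R, 0 < e -> nr z <= e) -> z = 0.
Proof.
move=> ze; apply/eqP; rewrite -nr_eq0 eq_le nr_ge0 andbT leNgt.
by apply/negP => z0; have := ze (nr z / 2); lra.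
Qed.

End ComplexNorm.

(** * Complex differentiability as first-order approximation *)

Section Differentiability.

Lemma derivable_approx (K : numFieldType) (f : K^o -> K^o) (z : K) :
  derivable f z 1 -> exists L : K, forall e : K, 0 < e ->
  exists2 d : K, 0 < d & forall y, `|y - z| < d ->
    `|f y - f z - L * (y - z)| <= e * `|y - z|.
Proof.
move=> df; exists ('D_1 f z : K) => e e0; set L : K := 'D_1 f z.
have fL : (fun h : K => h^-1 *: (f (h *: 1 + z) - f z)) @ 0^' --> L by exact: df.
have /cvgrPdist_lt/(_ e e0) := fL.
rewrite /= /dnbhs /within/= => /nbhs_ballP[d /= d0 H]; exists d => // y yz.
have [->|yz0] := eqVneq y z; first by rewrite !subrr mulr0 subrr normr0 mulr0.
have h0 : y - z != 0 by rewrite subr_eq0.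
have := H (y - z); rewrite /ball/= sub0r normrN => /(_ yz h0).
rewrite scaler1 subrK => /ltW.
rewrite -(ler_pM2r (x := `|y - z|)) ?normr_gt0// -normrM mulrBl.
by rewrite [_ *: _]mulrC mulfVK// distrC.
Qed.

Context {R : realType}.
Implicit Types (f g : R[i] -> R[i]) (z : R[i]).

(** Written without a quotient and with real [e] and [d]: the case y = z is included, and the
    estimate is the one that Goursat's argument consumes. *)
Definition cdiff f z := exists L : R[i], forall e : R, 0 < e ->
  exists2 d : R, 0 < d & forall y, nr (y - z) < d ->
    nr (f y - f z - L * (y - z)) <= e * nr (y - z).

Lemma holo_cdiff f z : holo_at f z -> cdiff f z.
Proof.
move=> /derivable_approx[L fL]; exists L => e e0.
have [|d d0 fd] := fL e%:C; first by rewrite ltcR.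
have dr : d = (complex.Re d)%:C by rewrite RRe_real// gtr0_real.
exists (complex.Re d); first by rewrite -ltcR -dr.
move=> y yz; have := fd y; rewrite dr !nrE ltcR => /(_ yz).
by rewrite -rmorphM/= lecR.
Qed.

Lemma cdiff_continuous {f z} : cdiff f z -> forall e : R, 0 < e ->
  exists2 d : R, 0 < d & forall y, nr (y - z) < d -> nr (f y - f z) < e.
Proof.
move=> [L /(_ 1 ltr01)[d d0 fd]] e e0.
have L0 := nr_ge0 L.
exists (Num.min d (e / (2 + nr L))).
  by rewrite lt_min d0 divr_gt0//; lra.
move=> y; rewrite lt_min => /andP[/fd yd].
rewrite ltr_pdivlMr; last lra.
have -> : f y - f z = (f y - f z - L * (y - z)) + L * (y - z) by ring.
have := nrD (f y - f z - L * (y - z)) (L * (y - z)).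
rewrite nrM; have := nr_ge0 (y - z); lra.
Qed.

Lemma cdiffM f g z : cdiff f z -> cdiff g z -> cdiff (fun y => f y * g y) z.
Proof.
move=> df dg; have fc := cdiff_continuous df.
case: df dg => [L fL] [M gM]; exists (L * g z + f z * M) => e e0.
have [L0 F0 G0] : [/\ 0 <= nr L, 0 <= nr (f z) & 0 <= nr (g z)].
  by split; exact: nr_ge0.
have M0 := nr_ge0 M.
(* The four error terms add up to at most e1 (|g z| + |M| + 1 + |f z|) |y - z|; the bound e1 <= 1
   handles the product of two small factors. *)
pose e1 := Num.min 1 (e / (2 + nr (f z) + nr (g z) + nr M)).
have D0 : 0 < 2 + nr (f z) + nr (g z) + nr M by lra.
have e10 : 0 < e1 by rewrite lt_min ltr01 divr_gt0.
have [e11 e1e] : e1 <= 1 /\ e1 * (2 + nr (f z) + nr (g z) + nr M) <= e.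
  by rewrite -ler_pdivlMr// !ge_min !lexx orbT.
have [d1 d10 H1] := fL _ e10; have [d2 d20 H2] := gM _ e10.
have [d3 d30 H3] := fc _ e10.
exists (Num.min d1 (Num.min d2 d3)); first by rewrite !lt_min d10 d20.
move=> y; rewrite !lt_min => /and3P[/H1 h1 /H2 h2 /H3 h3].
set E1 := f y - f z - L * (y - z) in h1.
set E2 := g y - g z - M * (y - z) in h2.
have -> : f y * g y - f z * g z - (L * g z + f z * M) * (y - z) =
   E1 * g z + ((f y - f z) * (M * (y - z)) + ((f y - f z) * E2 + f z * E2)).
  by rewrite /E1 /E2; ring.
apply: le_trans (nrD _ _) _; rewrite nrM.
have t1 := nrD ((f y - f z) * (M * (y - z))) ((f y - f z) * E2 + f z * E2).
have t2 := nrD ((f y - f z) * E2) (f z * E2).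
rewrite !nrM in t1 t2.
have n0 := nr_ge0 (y - z); have n1 := nr_ge0 E1; have n2 := nr_ge0 E2.
have n3 := nr_ge0 (f y - f z).
set X := nr (y - z) in h1 h2 n0 t1 t2 *.
have u1 : nr E1 * nr (g z) <= e1 * X * nr (g z) by rewrite ler_wpM2r.
have u2 : nr (f y - f z) * (nr M * X) <= e1 * (nr M * X).
  by rewrite ler_wpM2r ?mulr_ge0// ltW.
have u3 : nr (f y - f z) * nr E2 <= 1 * (e1 * X).
  by rewrite ler_pM//; lra.
have u4 : nr (f z) * nr E2 <= nr (f z) * (e1 * X) by rewrite ler_wpM2l.
have u5 : e1 * (2 + nr (f z) + nr (g z) + nr M) * X <= e * X.
  by rewrite ler_wpM2r.
have u6 : 0 <= e1 * X by rewrite mulr_ge0// ltW.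
lra.
Qed.

Lemma cdiff_affine f (k b z : R[i]) : cdiff f (k * z + b) ->
  cdiff (fun y => f (k * y + b)) z.
Proof.
move=> [L fL]; exists (L * k) => e e0.
have k0 := nr_ge0 k; have k1 : 0 < 1 + nr k by lra.
have [|d d0 fd] := fL (e / (1 + nr k)); first by rewrite divr_gt0.
exists (d / (1 + nr k)); first by rewrite divr_gt0.
move=> y; rewrite ltr_pdivlMr// => yz; have n0 := nr_ge0 (y - z).
have E : (k * y + b) - (k * z + b) = k * (y - z) by ring.
have := fd (k * y + b); rewrite E nrM mulrA.
have -> // : nr k * nr (y - z) < d by lra.
move=> /(_ isT) /le_trans -> //.
rewrite mulrAC -!mulrA ler_wpM2l ?(ltW e0)// mulrCA ler_piMr//.
by rewrite ler_pdivrMr; lra.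
Qed.

End Differentiability.

(** * The complex exponential *)

Section ComplexExponential.
Context {R : realType}.
Implicit Types (z : R[i]).

Lemma cexpD (a b : R[i]) : cexp (a + b) = cexp a * cexp b.
Proof.
case: a b => [a b] [c d]; rewrite /cexp /= expRD cosD sinD.
by apply/eqP; rewrite eq_complex /=; apply/andP; split; apply/eqP; ring.
Qed.

Lemma cexp0 : cexp (0 : R[i]) = 1.
Proof. by rewrite /cexp /= expR0 cos0 sin0 mul1r. Qed.

Lemma cexp_neq0 z : cexp z != 0.
Proof.
apply/eqP => z0; have := cexpD z (- z).
by rewrite z0 mul0r subrr cexp0 => /eqP; rewrite oner_eq0.
Qed.

Lemma cexpN z : cexp (- z) = (cexp z)^-1.
Proof.
apply: (mulfI (cexp_neq0 z)).
by rewrite -cexpD subrr cexp0 mulfV// cexp_neq0.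
Qed.

Lemma cexpMn z n : cexp (z *+ n) = cexp z ^+ n.
Proof.
by elim: n => [|n IH]; rewrite ?mulr0n ?cexp0// mulrS cexpD IH exprS.
Qed.

Lemma cexpMz z (k : int) : cexp (k%:~R * z) = cexp z ^ k.
Proof.
case: k => n; first by rewrite mulr_natl cexpMn.
by rewrite NegzE mulrNz mulNr cexpN mulr_natl cexpMn -exprnN.
Qed.

(** The addition theorem reduces to z = 0, where the real derivatives of [expR], [sin] and [cos]
    give the expansion. *)
Lemma cdiff_cexp z : cdiff cexp z.
Proof.
suff c0 : cdiff cexp (0 : R[i]).
  have -> : @cexp R = (fun y => cexp z * cexp (1 * y + (- z))).
    by apply/funext => y; rewrite -cexpD; congr cexp; ring.
  apply: cdiffM; last by apply: cdiff_affine; rewrite mul1r subrr.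
  by exists 0 => e e0; exists 1 => // y _; rewrite subrr mul0r subr0 nr0
    mulr_ge0 ?nr_ge0// ltW.
have app (f : R -> R) (D : R) : is_derive (0 : R) 1 f D -> forall e : R, 0 < e ->
    exists2 d : R, 0 < d & forall y, `|y| < d ->
      `|f y - f 0 - D * y| <= e * `|y|.
  move=> fD e e0.
  have fL : (fun h : R => h^-1 *: (f (h *: 1 + 0) - f 0)) @ 0^' --> D.
    rewrite -(@derive_val _ _ _ _ _ _ _ fD).
    exact: (@ex_derive _ _ _ _ _ _ _ fD).
  have /cvgrPdist_lt/(_ e e0) := fL.
  rewrite /= /dnbhs /within/= => /nbhs_ballP[d /= d0 H]; exists d => // y yd.
  have [->|y0] := eqVneq y 0; first by rewrite subrr mulr0 subrr normr0 mulr0.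
  have := H y; rewrite /ball/= sub0r normrN => /(_ yd y0).
  rewrite addr0 => /ltW.
  rewrite -(ler_pM2r (x := `|y|)) ?normr_gt0// -normrM mulrBl.
  by rewrite [_ *: 1]mulr1 [_ *: _]mulrC mulfVK// distrC.
exists 1 => e e0.
(* The errors below total at most six times this constant times N; the minimum with 1 also keeps |1
   + a| below 2. *)
have e4 : 0 < Num.min 1 e / 8 by rewrite divr_gt0// lt_min ltr01.
have [m1 me] : Num.min 1 e <= 1 /\ Num.min 1 e <= e.
  by rewrite !ge_min !lexx orbT.
have [d1 d10 H1] := app _ _ (is_derive_expR 0) _ e4.
have [d2 d20 H2] := app _ _ (is_derive_sin 0) _ e4.
have [d3 d30 H3] := app _ _ (is_derive_cos 0) _ e4.
exists (Num.min (Num.min d1 d2) (Num.min d3 (Num.min 1 e / 8))).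
  by rewrite !lt_min d10 d20 d30.
case=> a b; rewrite subr0 !lt_min => /andP[/andP[n1 n2] /andP[n3 n4]].
set N := nr (a +i* b) in n1 n2 n3 n4 *.
have ha : `|a| <= N := Re_le_nr (a +i* b).
have hb : `|b| <= N := Im_le_nr (a +i* b).
have := H1 a; have := H2 b; have := H3 b.
rewrite expR0 cos0 sin0 oppr0 mul0r subr0 addr0 !mul1r.
move=> /(_ (le_lt_trans hb n3)) h3 /(_ (le_lt_trans hb n2)) h2.
move=> /(_ (le_lt_trans ha n1)) h1.
rewrite cexp0.
set C : R[i] := cos b +i* sin b.
(* The errors of the two real expansions are separated; what remains is the second-order term i a
   b. *)
have -> : cexp (a +i* b) - 1 - a +i* b =
   (expR a - 1 - a)%:C * C + (((1 + a)%:C * (C - 1 - iC * b%:C)) + iC * (a * b)%:C).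
  apply/eqP; rewrite eq_complex /cexp /C/=; apply/andP.
  by split; apply/eqP; ring.
have nC : nr C = 1 by rewrite /nr/= cos2Dsin2 sqrtr1.
have nC1 : nr (C - 1 - iC * b%:C) <= 2 * (Num.min 1 e / 8 * `|b|).
  apply: le_trans (nr_le _) _.
  have -> : complex.Re (C - 1 - iC * b%:C) = cos b - 1 by rewrite /C/=; ring.
  have -> : complex.Im (C - 1 - iC * b%:C) = sin b - b by rewrite /C/=; ring.
  by lra.
apply: le_trans (nrD _ _) _; rewrite nrM nC nr_real mulr1.
have t := nrD ((1 + a)%:C * (C - 1 - iC * b%:C)) (iC * (a * b)%:C).
rewrite !nrM nr_i !nr_real mul1r normrM in t.
have a1 : `|1 + a| <= 2.
  by rewrite (le_trans (ler_normD _ _))// normr1; lra.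
have N0 : 0 <= N by exact: nr_ge0.
have a0 := normr_ge0 a; have b0 := normr_ge0 b.
have t2 : `|1 + a| * nr (C - 1 - iC * b%:C) <= 2 * (2 * (Num.min 1 e / 8 * `|b|)).
  by rewrite ler_pM ?nr_ge0.
have t3 : `|a| * `|b| <= Num.min 1 e / 8 * N.
  by rewrite ler_pM//; lra.
have t4 : Num.min 1 e * `|b| <= Num.min 1 e * N by rewrite ler_wpM2l//; lra.
have t5 : Num.min 1 e * `|a| <= Num.min 1 e * N by rewrite ler_wpM2l//; lra.
have t6 : Num.min 1 e * N <= e * N by rewrite ler_wpM2r.
have t7 : 0 <= Num.min 1 e * N by rewrite mulr_ge0//; lra.
lra.
Qed.

End ComplexExponential.


(** * Complex-valued integrals and Goursat's lemma on a rectangle *)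

Section ComplexIntegral.
Context {R : realType}.
Implicit Types (f g : R -> R[i]) (F : R[i] -> R[i]) (a b c d x y : R).

(** Componentwise, to match the integral, which is taken on real and imaginary parts; [ccontP] and
    [ccont_eps] translate to the modulus. *)
Definition ccont f x :=
  {for x, continuous (fun t => complex.Re (f t))} /\
  {for x, continuous (fun t => complex.Im (f t))}.

Definition ccseg a b f := forall x, a <= x <= b -> ccont f x.

Lemma ccontP f x : (forall e, 0 < e ->
    exists2 d, 0 < d & forall y, `|y - x| < d -> nr (f y - f x) < e) ->
  ccont f x.
Proof.
move=> fx; split; apply/cvgrPdist_lt => e e0; have [d d0 fd] := fx _ e0;
  exists d => // y; rewrite /= distrC => /fd; apply: le_lt_trans;
  rewrite distrC.
  by apply: le_trans (Re_le_nr (f y - f x)); case: (f y) (f x) => ? ? [].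
by apply: le_trans (Im_le_nr (f y - f x)); case: (f y) (f x) => ? ? [].
Qed.

Lemma ccont_eps f x : ccont f x -> forall e, 0 < e ->
    exists2 d, 0 < d & forall y, `|y - x| < d -> nr (f y - f x) < e.
Proof.
move=> [/cvgrPdist_lt fr /cvgrPdist_lt fi] e e0.
have e2 : 0 < e / 2 by lra.
have [d1 /= d10 H1] := fr _ e2; have [d2 /= d20 H2] := fi _ e2.
exists (Num.min d1 d2); first by rewrite lt_min d10.
move=> y; rewrite lt_min distrC => /andP[/H1/= h1 /H2/= h2].
apply: le_lt_trans (nr_le _) _.
move: h1 h2; case: (f y) (f x) => u v [u' v'] /=.
by rewrite distrC => h1; rewrite distrC => h2; lra.
Qed.

Lemma ccont_cst k x : ccont (fun=> k) x.
Proof. by split; exact: cst_continuous. Qed.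

Lemma ccontD f g x : ccont f x -> ccont g x -> ccont (fun t => f t + g t) x.
Proof.
move=> [f1 f2] [g1 g2]; split.
  have -> : (fun t => complex.Re (f t + g t)) =
    (fun t => complex.Re (f t) + complex.Re (g t)).
    by apply/funext => t; case: (f t) (g t) => ? ? [].
  exact: continuousD.
have -> : (fun t => complex.Im (f t + g t)) =
  (fun t => complex.Im (f t) + complex.Im (g t)).
  by apply/funext => t; case: (f t) (g t) => ? ? [].
exact: continuousD.
Qed.

Lemma ccontM f g x : ccont f x -> ccont g x -> ccont (fun t => f t * g t) x.
Proof.
move=> [f1 f2] [g1 g2]; split.
  have -> : (fun t => complex.Re (f t * g t)) = (fun t => complex.Re (f t) *
    complex.Re (g t) - complex.Im (f t) * complex.Im (g t)).
    by apply/funext => t; case: (f t) (g t) => ? ? [].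
  by apply: continuousB; exact: continuousM.
have -> : (fun t => complex.Im (f t * g t)) = (fun t => complex.Re (f t) *
    complex.Im (g t) + complex.Im (f t) * complex.Re (g t)).
  by apply/funext => t; case: (f t) (g t) => ? ? [].
by apply: continuousD; exact: continuousM.
Qed.

Lemma ccontN f x : ccont f x -> ccont (fun t => - f t) x.
Proof.
move=> fx; have := ccontM _ _ _ (ccont_cst (-1) x) fx.
by under eq_fun do rewrite mulN1r.
Qed.

Lemma ccontB f g x : ccont f x -> ccont g x -> ccont (fun t => f t - g t) x.
Proof. by move=> fx gx; apply: ccontD => //; exact: ccontN. Qed.

Lemma ccontX f n x : ccont f x -> ccont (fun t => f t ^+ n) x.
Proof.
move=> fx; elim: n => [|n IH]; first exact: ccont_cst.
by under eq_fun do rewrite exprS; exact: ccontM.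
Qed.

Lemma ccontV f x : f x != 0 -> ccont f x -> ccont (fun t => (f t)^-1) x.
Proof.
move=> f0 /ccont_eps fx; apply: ccontP => e e0.
pose N := nr (f x).
have N0 : 0 < N by rewrite lt_neqAle eq_sym nr_eq0 f0 nr_ge0.
have [|d d0 H] := fx (Num.min (N / 2) (e * (N * N) / 2)).
  by rewrite lt_min !divr_gt0// !mulr_gt0.
exists d => // y /H; rewrite lt_min => /andP[h1 h2].
have h3 : N / 2 < nr (f y).
  have := nrD (f y) (f x - f y); rewrite addrC subrK (nrB (f x)) -/N; lra.
have fy0 : f y != 0 by rewrite -nr_eq0 gt_eqF//; lra.
have e1 : nr ((f y)^-1 - (f x)^-1) * (nr (f y) * N) = nr (f y - f x).
  rewrite -!nrM [RHS]nrB; congr nr; field.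
  by rewrite f0 fy0.
rewrite -(ltr_pM2r (x := nr (f y) * N)); last by rewrite mulr_gt0//; lra.
rewrite e1; apply: (lt_le_trans h2).
rewrite -!mulrA ler_wpM2l ?(ltW e0)//; nra.
Qed.

Lemma ccontXz f (k : int) x : f x != 0 -> ccont f x ->
  ccont (fun t => f t ^ k) x.
Proof.
move=> f0 fx; case: k => n; first exact: ccontX.
rewrite NegzE; under eq_fun do rewrite -exprnN -exprVn.
exact/ccontX/ccontV.
Qed.

Lemma ccont_sum (I : Type) (s : seq I) (f : I -> R -> R[i]) x :
  (forall i, ccont (f i) x) -> ccont (fun t => \sum_(i <- s) f i t) x.
Proof.
move=> fx; elim: s => [|i s IH].
  by under eq_fun do rewrite big_nil; exact: ccont_cst.
by under eq_fun do rewrite big_cons; exact: ccontD.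
Qed.

(** On [0, 1] this is convertible with [cint01]. *)
Definition cint a b f : R[i] := (rint a b (fun x => complex.Re (f x)))%:C
  + iC * (rint a b (fun x => complex.Im (f x)))%:C.

Lemma Re_cint a b f : complex.Re (cint a b f) = rint a b (fun x => complex.Re (f x)).
Proof. by rewrite /cint /=; ring. Qed.

Lemma Im_cint a b f : complex.Im (cint a b f) = rint a b (fun x => complex.Im (f x)).
Proof. by rewrite /cint /=; ring. Qed.

Lemma eq_cint a b f g : (forall x, a <= x <= b -> f x = g x) ->
  cint a b f = cint a b g.
Proof.
by move=> fg; congr (_%:C + iC * _%:C); apply: eq_rint => x /fg ->.
Qed.

Lemma ccseg_Re a b f : ccseg a b f -> cseg a b (fun x => complex.Re (f x)).
Proof. by move=> fc x /fc[]. Qed.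

Lemma ccseg_Im a b f : ccseg a b f -> cseg a b (fun x => complex.Im (f x)).
Proof. by move=> fc x /fc[]. Qed.

Lemma cintD a b f g : ccseg a b f -> ccseg a b g ->
  cint a b (fun x => f x + g x) = cint a b f + cint a b g.
Proof.
move=> fc gc; rewrite /cint.
have := rintD a b _ _ (ccseg_Re _ _ _ fc) (ccseg_Re _ _ _ gc).
have := rintD a b _ _ (ccseg_Im _ _ _ fc) (ccseg_Im _ _ _ gc).
rewrite (@eq_rint _ a b (fun x => complex.Re (f x + g x))
  (fun x => complex.Re (f x) + complex.Re (g x))); last first.
  by move=> x _; case: (f x) (g x) => ? ? [].
rewrite (@eq_rint _ a b (fun x => complex.Im (f x + g x))
  (fun x => complex.Im (f x) + complex.Im (g x))); last first.
  by move=> x _; case: (f x) (g x) => ? ? [].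
by move=> -> ->; rewrite !rmorphD/=; ring.
Qed.

Lemma cintZ a b k f : ccseg a b f ->
  cint a b (fun x => k * f x) = k * cint a b f.
Proof.
move=> fc; have fr := ccseg_Re _ _ _ fc; have fi := ccseg_Im _ _ _ fc.
have zc l h : cseg a b h -> cseg a b (fun x => l * h x).
  by move=> hc x /hc hx; apply: continuousM => //; exact: cst_continuous.
rewrite /cint; case: k => u v.
rewrite (@eq_rint _ a b (fun x => complex.Re ((u +i* v) * f x))
  (fun x => u * complex.Re (f x) + (- v) * complex.Im (f x))); last first.
  by move=> x _; case: (f x) => ? ? /=; ring.
rewrite (@eq_rint _ a b (fun x => complex.Im ((u +i* v) * f x))
  (fun x => u * complex.Im (f x) + v * complex.Re (f x))); last first.
  by move=> x _; case: (f x) => ? ? /=; ring.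
rewrite !rintD ?rintZ//; try exact: zc.
by apply/eqP; rewrite eq_complex /=; apply/andP; split; apply/eqP; ring.
Qed.

Lemma cintB a b f g : ccseg a b f -> ccseg a b g ->
  cint a b (fun x => f x - g x) = cint a b f - cint a b g.
Proof.
move=> fc gc.
have -> : (fun x => f x - g x) = (fun x => f x + (-1) * g x).
  by apply/funext => x; rewrite mulN1r.
have gN : ccseg a b (fun x => (-1) * g x).
  by move=> x /gc; exact: (ccontM _ _ _ (ccont_cst _ _)).
by rewrite (cintD _ _ _ _ fc gN) (cintZ _ _ _ _ gc) mulN1r.
Qed.

Lemma cint_cst a b k : a <= b -> cint a b (fun=> k) = k * (b - a)%:C.
Proof.
move=> ab; rewrite /cint !rint_cst//.
by case: k => u v; apply/eqP; rewrite eq_complex /=; apply/andP; split;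
  apply/eqP; ring.
Qed.

Lemma cint_cat a c b f : a <= c -> c <= b -> ccseg a b f ->
  cint a b f = cint a c f + cint c b f.
Proof.
move=> ac cb fc; rewrite /cint.
rewrite (rint_cat _ _ _ _ ac cb (ccseg_Re _ _ _ fc)).
rewrite (rint_cat _ _ _ _ ac cb (ccseg_Im _ _ _ fc)).
by rewrite !rmorphD/=; ring.
Qed.

(** The factor 2 comes from bounding the real and imaginary parts separately; the later estimates
    absorb it. *)
Lemma cint_norm a b k f : a <= b -> ccseg a b f ->
  (forall x, a <= x <= b -> nr (f x) <= k) ->
  nr (cint a b f) <= 2 * k * (b - a).
Proof.
move=> ab fc fk; apply: le_trans (nr_le _) _; rewrite Re_cint Im_cint.
have h1 : `|rint a b (fun x => complex.Re (f x))| <= k * (b - a).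
  apply: rint_norm => //; first exact: ccseg_Re.
  by move=> x /fk; apply: le_trans; exact: Re_le_nr.
have h2 : `|rint a b (fun x => complex.Im (f x))| <= k * (b - a).
  apply: rint_norm => //; first exact: ccseg_Im.
  by move=> x /fk; apply: le_trans; exact: Im_le_nr.
lra.
Qed.

Lemma cint_sum (I : Type) (s : seq I) (f : I -> R -> R[i]) a b :
  (forall i, ccseg a b (f i)) ->
  cint a b (fun t => \sum_(i <- s) f i t) = \sum_(i <- s) cint a b (f i).
Proof.
move=> fc; elim: s => [|i s IH].
  rewrite big_nil (@eq_cint _ _ _ (fun t => 0 * 0)); last first.
    by move=> x _; rewrite big_nil mul0r.
  by rewrite cintZ ?mul0r// => x _; exact: ccont_cst.
rewrite big_cons -IH -cintD//.
  by apply: eq_cint => x _; rewrite big_cons.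
by move=> x hx; apply: ccont_sum => j; exact: fc.
Qed.

Lemma ccont_line F (z d : R[i]) x : cdiff F (z + x%:C * d) ->
  ccont (fun t => F (z + t%:C * d)) x.
Proof.
move=> /cdiff_continuous Fc; apply: ccontP => e e0.
have [r r0 H] := Fc _ e0; have n0 := nr_ge0 d.
exists (r / (1 + nr d)); first by rewrite divr_gt0//; lra.
move=> y; rewrite ltr_pdivlMr; last lra.
move=> yx; apply: H.
have -> : z + y%:C * d - (z + x%:C * d) = (y - x)%:C * d.
  by rewrite rmorphB/=; ring.
by rewrite nrM nr_real; have := normr_ge0 (y - x); lra.
Qed.

Lemma ccont_hor F y x : cdiff F (x +i* y) -> ccont (fun t => F (t +i* y)) x.
Proof.
have E t : t +i* y = 0 +i* y + t%:C * 1.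
  by apply/eqP; rewrite eq_complex /=; apply/andP; split; apply/eqP; ring.
rewrite E => /ccont_line.
by under eq_fun do rewrite -E.
Qed.

Lemma ccont_ver F x y : cdiff F (x +i* y) -> ccont (fun t => F (x +i* t)) y.
Proof.
have E t : x +i* t = x%:C + t%:C * iC.
  by apply/eqP; rewrite eq_complex /=; apply/andP; split; apply/eqP; ring.
rewrite E => /ccont_line.
by under eq_fun do rewrite -E.
Qed.

End ComplexIntegral.

(** * Goursat's lemma by bisection *)

Section Goursat.
Context {R : realType}.
Implicit Types (F : R[i] -> R[i]) (a b c d x y w h : R).

(** The counterclockwise boundary integral over [a, b] x [c, d], with opposite sides paired. *)
Definition rectint F a b c d : R[i] :=
  cint a b (fun x => F (x +i* c) - F (x +i* d)) +
  iC * cint c d (fun y => F (b +i* y) - F (a +i* y)).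

Definition cdiff_rect F a b c d :=
  forall x y, a <= x <= b -> c <= y <= d -> cdiff F (x +i* y).

Lemma cdiff_rect_hor F a b c d u v y : cdiff_rect F a b c d ->
  a <= u -> v <= b -> c <= y <= d -> ccseg u v (fun x => F (x +i* y)).
Proof.
move=> Fd au vb yd x /andP[ux xv]; apply: ccont_hor; apply: Fd => //.
by rewrite (le_trans au)//= (le_trans xv).
Qed.

Lemma cdiff_rect_ver F a b c d u v x : cdiff_rect F a b c d ->
  c <= u -> v <= d -> a <= x <= b -> ccseg u v (fun y => F (x +i* y)).
Proof.
move=> Fd au vb yd y /andP[ux xv]; apply: ccont_ver; apply: Fd => //.
by rewrite (le_trans au)//= (le_trans xv).
Qed.

Lemma rectint_catx F a e b c d : a <= e -> e <= b -> c <= d ->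
  cdiff_rect F a b c d ->
  rectint F a b c d = rectint F a e c d + rectint F e b c d.
Proof.
move=> ae eb cd Fd; rewrite /rectint (cint_cat a e b)//; last first.
  by move=> x hx; apply: ccontB; (apply: cdiff_rect_hor Fd _ _ _ _ hx; lra).
have H u : a <= u <= b -> ccseg c d (fun y => F (u +i* y)).
  by move=> hu; apply: cdiff_rect_ver Fd _ _ hu.
rewrite !(@cintB _ c d); try (apply: H; lra).
by ring.
Qed.

Lemma rectint_caty F a b c e d : a <= b -> c <= e -> e <= d ->
  cdiff_rect F a b c d ->
  rectint F a b c d = rectint F a b c e + rectint F a b e d.
Proof.
move=> ab ce ed Fd; rewrite /rectint (cint_cat c e d)//; last first.
  by move=> x hx; apply: ccontB; (apply: cdiff_rect_ver Fd _ _ _ _ hx; lra).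
have H u : c <= u <= d -> ccseg a b (fun x => F (x +i* u)).
  by move=> hu; apply: cdiff_rect_hor Fd _ _ hu.
rewrite !(@cintB _ a b); try (apply: H; lra).
by ring.
Qed.

Lemma cdiff_rectS F a b c d a' b' c' d' : cdiff_rect F a b c d ->
  a <= a' -> b' <= b -> c <= c' -> d' <= d -> cdiff_rect F a' b' c' d'.
Proof. by move=> Fd h1 h2 h3 h4 x y hx hy; apply: Fd; lra. Qed.

(* The affine part of [F] at the base point contributes nothing, because the
   differences in [rectint] of an affine function are constant. *)
Lemma rectint_small F x0 y0 (e : R) : cdiff F (x0 +i* y0) -> 0 < e ->
  exists2 r, 0 < r & forall a c w h, 0 <= w -> 0 <= h -> w + h < r ->
    a <= x0 <= a + w -> c <= y0 <= c + h ->
    cdiff_rect F a (a + w) c (c + h) ->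
    nr (rectint F a (a + w) c (c + h)) <= e * (w + h) ^+ 2.
Proof.
(* With e/4, the difference over two opposite sides is at most e/2 (w + h); the factor 2 of
   [cint_norm] and the lengths w and h give e (w + h)^2. *)
move=> [L FL] e0; have [|r r0 Fr] := FL (e / 4); first lra.
exists r => // a c w h w0 h0 wh ax cy Fd.
pose E z := F z - F (x0 +i* y0) - L * (z - x0 +i* y0).
have Ee x y : a <= x <= a + w -> c <= y <= c + h ->
    nr (E (x +i* y)) <= e / 4 * (w + h).
  move=> hx hy; have n : nr (x +i* y - x0 +i* y0) <= w + h.
    apply: le_trans (nr_le _) _ => /=.
    have : `|x - x0| <= w by rewrite ler_norml; lra.
    have : `|y - y0| <= h by rewrite ler_norml; lra.
    lra.
  apply: le_trans (Fr _ _) _; first lra.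
  by rewrite ler_wpM2l//; lra.
have H1 u : c <= u <= c + h -> ccseg a (a + w) (fun x => F (x +i* u)).
  by move=> hu; apply: cdiff_rect_hor Fd _ _ hu.
have H2 u : a <= u <= a + w -> ccseg c (c + h) (fun y => F (u +i* y)).
  by move=> hu; apply: cdiff_rect_ver Fd _ _ hu.
have cc a' b' (k : R[i]) : ccseg a' b' (fun=> k) by move=> *; exact: ccont_cst.
pose G1 x := F (x +i* c) - F (x +i* (c + h)).
pose G2 y := F ((a + w) +i* y) - F (a +i* y).
have G1c : ccseg a (a + w) G1.
  by move=> x hx; apply: ccontB; (apply: H1 hx; lra).
have G2c : ccseg c (c + h) G2.
  by move=> x hx; apply: ccontB; (apply: H2 hx; lra).
(* These are the constant differences of the affine part over opposite sides: bottom minus top and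
   right minus left. They satisfy k1 w + i k2 h = 0. *)
pose k1 := - (L * (iC * h%:C)); pose k2 := L * w%:C.
have -> : rectint F a (a + w) c (c + h) =
    cint a (a + w) (fun x => G1 x - k1) + iC * cint c (c + h) (fun y => G2 y - k2).
  rewrite [in RHS]cintB// cint_cst ?lerDl//.
  rewrite (@cintB _ c (c + h))// cint_cst ?lerDl//.
  have -> : a + w - a = w by ring.
  have -> : c + h - c = h by ring.
  by rewrite /rectint -/G1 -/G2 /k1 /k2; ring.
have b1 : nr (cint a (a + w) (fun x => G1 x - k1)) <= 2 * (e / 2 * (w + h)) * (a + w - a).
  apply: cint_norm; rewrite ?lerDl//.
    by move=> x hx; apply: ccontB (G1c _ hx) (ccont_cst _ _).
  move=> x hx; have -> : G1 x - k1 = E (x +i* c) - E (x +i* (c + h)).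
    rewrite /G1 /k1 /E.
    have -> : x +i* (c + h) = x +i* c + iC * h%:C.
      by apply/eqP; rewrite eq_complex /=; apply/andP; split; apply/eqP; ring.
    by ring.
  apply: le_trans (nrD _ _) _; rewrite nrN.
  have := Ee x c hx; have := Ee x (c + h) hx.
  have -> : c <= c + h <= c + h by lra.
  have -> : c <= c <= c + h by lra.
  by move=> /(_ isT) + /(_ isT); lra.
have b2 : nr (cint c (c + h) (fun x => G2 x - k2)) <= 2 * (e / 2 * (w + h)) * (c + h - c).
  apply: cint_norm; rewrite ?lerDl//.
    by move=> x hx; apply: ccontB (G2c _ hx) (ccont_cst _ _).
  move=> y hy; have -> : G2 y - k2 = E ((a + w) +i* y) - E (a +i* y).
    rewrite /G2 /k2 /E.
    have -> : (a + w) +i* y = a +i* y + w%:C.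
      by apply/eqP; rewrite eq_complex /=; apply/andP; split; apply/eqP; ring.
    by ring.
  apply: le_trans (nrD _ _) _; rewrite nrN.
  have := Ee a y _ hy; have := Ee (a + w) y _ hy.
  have -> : a <= a + w <= a + w by lra.
  have -> : a <= a <= a + w by lra.
  by move=> /(_ isT) + /(_ isT); lra.
apply: le_trans (nrD _ _) _; rewrite nrM nr_i mul1r.
by rewrite expr2; lra.
Qed.

(** The inner sides cancel, so the integral is the sum over the four quarters and one of them
    carries more than k / 4. *)
Lemma rectint_quarter F a c w h (k : R) : 0 <= w -> 0 <= h ->
  cdiff_rect F a (a + w) c (c + h) ->
  k < nr (rectint F a (a + w) c (c + h)) ->
  exists a' c', [/\ a <= a' <= a + w / 2, c <= c' <= c + h / 2 &
    k / 4 < nr (rectint F a' (a' + w / 2) c' (c' + h / 2))].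
Proof.
move=> w0 h0 Fd kF.
have [w2 h2] : a + w / 2 + w / 2 = a + w /\ c + h / 2 + h / 2 = c + h.
  by split; field.
rewrite (rectint_catx F a (a + w / 2)) in kF => //; try lra.
rewrite (rectint_caty F a (a + w / 2) c (c + h / 2)) in kF; try lra; last first.
  by apply: cdiff_rectS Fd _ _ _ _; lra.
rewrite (rectint_caty F (a + w / 2) (a + w) c (c + h / 2)) in kF; try lra; last first.
  by apply: cdiff_rectS Fd _ _ _ _; lra.
rewrite -w2 -h2 in kF.
set r1 := rectint F a _ c _ in kF; set r2 := rectint F a _ _ _ in kF.
set r3 := rectint F _ _ c _ in kF; set r4 := rectint F _ _ _ _ in kF.
have s1 := nrD (r1 + r2) (r3 + r4); have s2 := nrD r1 r2; have s3 := nrD r3 r4.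
have key : [\/ k / 4 < nr r1, k / 4 < nr r2, k / 4 < nr r3 | k / 4 < nr r4].
  have [l1|l1] := ltP (k / 4) (nr r1); first by constructor 1.
  have [l2|l2] := ltP (k / 4) (nr r2); first by constructor 2.
  have [l3|l3] := ltP (k / 4) (nr r3); first by constructor 3.
  constructor 4; move: (nr (r1 + r2 + (r3 + r4))) (nr (r1 + r2)) (nr (r3 + r4))
    (nr r1) (nr r2) (nr r3) (nr r4) kF s1 s2 s3 l1 l2 l3.
  by clear; move=> *; lra.
have [hw hh] : 0 <= w / 2 /\ 0 <= h / 2 by rewrite !divr_ge0.
case: key => key; [exists a, c|exists a, (c + h / 2)|
  exists (a + w / 2), c|exists (a + w / 2), (c + h / 2)];
  by split; rewrite ?lexx ?lerDl ?hw ?hh.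
Qed.

(** Every left end lies below every right end, so the supremum of the left ends belongs to all the
    intervals. *)
Lemma nested_point (A w : nat -> R) : (forall n, A n <= A n.+1) ->
  (forall n, A n.+1 + w n.+1 <= A n + w n) -> (forall n, 0 <= w n) ->
  exists x, forall n, A n <= x <= A n + w n.
Proof.
move=> Ai Aw w0.
have Am := (nondecreasing_seqP A).1 Ai.
have Bm := (nonincreasing_seqP (fun n => A n + w n)).1 Aw.
have AB n m : A n <= A m + w m.
  have [nm|mn] := leqP n m.
    by rewrite (le_trans (Am _ _ (nm : (n <= m)%O)))// lerDl.
  by rewrite (le_trans _ (Bm _ _ (ltnW mn : (m <= n)%O)))// lerDl.
exists (sup (range A)) => n; apply/andP; split.
  apply: ub_le_sup; last by exists n.
  by exists (A 0%N + w 0%N) => _ [m _ <-].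
by apply: ge_sup; [exists (A n), n|move=> _ [m _ <-]].
Qed.

(** Were the integral nonzero, repeated quartering would keep it above K / 4^n on rectangles
    shrinking to a point, whereas differentiability at that point makes it smaller than any fixed
    multiple of the squared size. *)
Lemma goursat F a b c d : a < b -> c < d -> cdiff_rect F a b c d ->
  rectint F a b c d = 0.
Proof.
move=> ab cd Fd; apply/eqP; rewrite -nr_eq0 eq_le nr_ge0 andbT leNgt.
apply/negP => J0.
pose W := b - a; pose H := d - c.
have [W0 H0] : 0 < W /\ 0 < H by rewrite !subr_gt0.
pose w n : R := W / 2 ^+ n; pose h n : R := H / 2 ^+ n.
have p2 n : 0 < 2 ^+ n :> R by rewrite exprn_gt0.
have wS n : w n.+1 = w n / 2.
  by rewrite /w exprS; field; have := p2 n; lra.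
have hS n : h n.+1 = h n / 2.
  by rewrite /h exprS; field; have := p2 n; lra.
have w0 n : 0 < w n by rewrite divr_gt0.
have h0 n : 0 < h n by rewrite divr_gt0.
(* Halving makes the inequality strict at stage 0. *)
pose K := nr (rectint F a b c d) / 2.
pose inside n (s : R * R) := [/\ a <= s.1, s.1 + w n <= b, c <= s.2, s.2 + h n <= d &
   K / 4 ^+ n < nr (rectint F s.1 (s.1 + w n) s.2 (s.2 + h n))].
pose next n (s s' : R * R) := [/\ s.1 <= s'.1, s'.1 + w n.+1 <= s.1 + w n,
   s.2 <= s'.2 & s'.2 + h n.+1 <= s.2 + h n].
(* Stated for every pair, with a default successor outside [inside], so that [choice] yields a total
   function. *)
have step (ns : nat * (R * R)) : exists s', inside ns.1 ns.2 ->
    inside ns.1.+1 s' /\ next ns.1 ns.2 s'.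
  case: ns => n s /=; have [[i1 i2 i3 i4 i5]|ni] := pselect (inside n s); last first.
    by exists s => /ni.
  have [||||a' [c' [ha hc hJ]]] := @rectint_quarter F s.1 s.2 (w n) (h n) (K / 4 ^+ n).
  - exact/ltW.
  - exact/ltW.
  - exact: cdiff_rectS Fd _ _ _ _.
  - exact: i5.
  exists (a', c') => _; rewrite /inside /next /= wS hS.
  split; split; try lra.
  by rewrite exprS invfM mulrA mulrAC.
have {step}[nx nxP] := choice step.
pose fix sq n := if n is m.+1 then nx (m, sq m) else (a, c).
have sqI n : inside n (sq n).
  elim: n => [|n IH]; last by have [] := nxP (n, sq n) IH.
  rewrite /inside /w /h /W /H /= !expr0 !divr1; split; try lra.
  have -> : a + (b - a) = b by ring.
  have -> : c + (d - c) = d by ring.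
  by rewrite /K; lra.
have sqN n : next n (sq n) (sq n.+1) by have [] := nxP (n, sq n) (sqI n).
have [x0 hx] : exists x, forall n, (sq n).1 <= x <= (sq n).1 + w n.
  by apply: nested_point => n; [have [] := sqN n|have [] := sqN n|exact/ltW].
have [y0 hy] : exists y, forall n, (sq n).2 <= y <= (sq n).2 + h n.
  by apply: nested_point => n; [have [] := sqN n|have [] := sqN n|exact/ltW].
(* Chosen so that e (w n + h n)^2 is exactly K / 4^n. *)
pose e := K / (W + H) ^+ 2.
have K0 : 0 < K by rewrite divr_gt0.
have WH : 0 < W + H by lra.
have e0 : 0 < e by rewrite divr_gt0// exprn_gt0.
have Fz : cdiff F (x0 +i* y0).
  have := hx 0%N; have := hy 0%N; rewrite /= /w /h /W /H expr0 !divr1 => ? ?.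
  by apply: Fd; lra.
have [r r0 Hr] := rectint_small F x0 y0 e Fz e0.
have [n hn] : exists n, (1 / 2) ^+ n < r / (W + H).
  by apply: exists_expr_lt; [lra|rewrite divr_gt0].
have [i1 i2 i3 i4 i5] := sqI n.
have := Hr (sq n).1 (sq n).2 (w n) (h n) (ltW (w0 n)) (ltW (h0 n)) _ (hx n) (hy n).
have wh : w n + h n = (1 / 2) ^+ n * (W + H).
  by rewrite /w /h expr_div_n expr1n; field; have := p2 n; lra.
rewrite wh -ltr_pdivlMr// => /(_ hn).
have Fn : cdiff_rect F (sq n).1 ((sq n).1 + w n) (sq n).2 ((sq n).2 + h n).
  exact: cdiff_rectS Fd _ _ _ _.
move=> /(_ Fn) /(lt_le_trans i5); rewrite /e exprMn mulrCA divfK; last first.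
  by rewrite expf_neq0// gt_eqF.
rewrite -exprM muln2 -addnn exprD -exprMn mulrC.
have -> : (1 / 2 * (1 / 2)) ^+ n = (4 ^+ n)^-1 :> R.
  by rewrite -exprVn; congr (_ ^+ _); field.
by rewrite mulrC ltxx.
Qed.

(** Periodicity cancels the two vertical sides in Goursat's lemma, leaving the horizontal ones. *)
Lemma periodic_strip_shift F y1 y2 : y1 < y2 -> cdiff_rect F 0 1 y1 y2 ->
  (forall y, y1 <= y <= y2 -> F (1 +i* y) = F (0 +i* y)) ->
  cint 0 1 (fun x => F (x +i* y1)) = cint 0 1 (fun x => F (x +i* y2)).
Proof.
move=> y12 Fd Fp; have := goursat F 0 1 y1 y2 ltr01 y12 Fd.
rewrite /rectint (@eq_cint _ y1 y2 _ (fun=> 0)); last first.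
  by move=> y /Fp ->; rewrite subrr.
rewrite cint_cst ?(ltW y12)// mul0r mulr0 addr0 cintB.
- by move/eqP; rewrite subr_eq0 => /eqP.
- by apply: cdiff_rect_hor Fd _ _ _; lra.
- by apply: cdiff_rect_hor Fd _ _ _; lra.
Qed.

End Goursat.


(** * Generation of the algebra *)

Section AlgebraMorphism.
Context {R : realType} {A B : algType R[i]} (f : {lrmorphism A -> B}).

Lemma lrmorph_Zpow (Z Zi : A) k : f (Zpow Z Zi k) = Zpow (f Z) (f Zi) k.
Proof. by case: k => n; rewrite /= rmorphXn. Qed.

Lemma lrmorph_laurA (Z Zi : A) (p : {poly R[i]}) m al :
  f (laurA Z Zi p m al) = laurA (f Z) (f Zi) p m al.
Proof.
by rewrite linear_sum; apply: eq_bigr => k _; rewrite linearZ_LR/= lrmorph_Zpow.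
Qed.

End AlgebraMorphism.

(** * Induction over the generators, from the universal property *)

Section Subalgebra.
Context {R : realType} {A : algType R[i]} (W : A -> Prop).

Definition subalg_pred : {pred A} := fun a => `[< W a >].

Context (W1 : W 1) (WD : forall a b, W a -> W b -> W (a + b))
  (WZ : forall k a, W a -> W (k *: a)) (WM : forall a b, W a -> W b -> W (a * b)).

Lemma subalg_pred_closed : GRing.subalg_closed subalg_pred.
Proof.
split.
- exact/asboolP.
- by move=> k a b /asboolP Wa /asboolP Wb; apply/asboolP/WD => //; exact: WZ.
- by move=> a b /asboolP Wa /asboolP Wb; exact/asboolP/WM.
Qed.

HB.instance Definition _ :=
  GRing.isSubalgClosed.Build R[i] A subalg_pred subalg_pred_closed.

Record subalg := SubAlg { subalg_val :> A; _ : subalg_val \in subalg_pred }.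

HB.instance Definition _ := [isSub for subalg_val].
HB.instance Definition _ := [Choice of subalg by <:].
HB.instance Definition _ := [SubChoice_isSubAlgebra of subalg by <:].

Definition subalg_incl : subalg -> A := val.

HB.instance Definition _ :=
  GRing.RMorphism.copy subalg_incl (val : subalg -> A).
HB.instance Definition _ := GRing.Linear.copy subalg_incl (val : subalg -> A).

(** The universal property maps A into the subalgebra cut out by W. Composed with the inclusion,
    this map fixes the generators, hence is the identity, so every element satisfies W. *)
Lemma is_AP_ind (q : R) (p : {poly R[i]}) m (u v Z Zi : A) :
  is_AP q p m u v Z Zi -> W u -> W v -> W Z -> W Zi -> forall a, W a.
Proof.
move=> [[ZZi ZiZ Zu Zv [uv vu]] univ] Wu Wv WZ0 WZi a.
have sb (b : A) : W b -> b \in subalg_pred by move=> Wb; exact/asboolP.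
pose u' := SubAlg _ (sb _ Wu); pose v' := SubAlg _ (sb _ Wv).
pose Z' := SubAlg _ (sb _ WZ0); pose Zi' := SubAlg _ (sb _ WZi).
pose incl : {lrmorphism subalg -> A} := subalg_incl.
have rel : AP_rel q p m u' v' Z' Zi'.
  have inj : injective incl := val_inj.
  split; last split; apply: inj.
  - by rewrite rmorphM rmorph1.
  - by rewrite rmorphM rmorph1.
  - by rewrite linearZ_LR !rmorphM.
  - by rewrite linearZ_LR !rmorphM.
  - by rewrite lrmorph_laurA; apply: etrans uv; exact: (rmorphM incl u' v').
  - by rewrite lrmorph_laurA; apply: etrans vu; exact: (rmorphM incl v' u').
have [f [fu fv fZ fZi _]] := univ _ _ _ _ _ rel.
(* Uniqueness is applied with A itself as target, to identify the composite and the identity with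
   the same morphism k. *)
have [k [_ _ _ _ kU]] := univ A u v Z Zi (And5 ZZi ZiZ Zu Zv (conj uv vu)).
have := kU (incl \o f : {lrmorphism A -> A}); have := kU (idfun : {lrmorphism A -> A}).
rewrite /= fu fv fZ fZi => /(_ erefl erefl erefl erefl a) ka.
move=> /(_ erefl erefl erefl erefl a); rewrite -ka => <-.
by case: (f a) => b Wb; exact/asboolP.
Qed.

End Subalgebra.


(** * Laurent polynomials *)

Section LaurentFunctions.
Context {R : realType}.
Implicit Types (s t : seq (R[i] * int)) (z lam : R[i]).

(* A Laurent polynomial [sum c Z^k] is given by the list of its terms [(c, k)];
   [lfun] is the associated function on the punctured plane. *)
Definition lfun s z : R[i] := \sum_(x <- s) x.1 * z ^ x.2.

Definition lmul s t := [seq (x.1 * y.1, x.2 + y.2) | x <- s, y <- t].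

Definition lscale lam s := [seq (x.1 * lam ^ x.2, x.2) | x <- s].

(** The involution sending R(z) to the conjugate of R(1 / conj z): complex conjugation of values on
    the unit circle, and the action of [rho] in degree 0. *)
Definition lconj s := [seq (conjc x.1, - x.2) | x <- s].

(** The terms of P(al Z), that is, the list form of [laurA]. *)
Definition lpoly (p : {poly R[i]}) (m : int) (al : R[i]) :=
  [seq (p`_k * al ^ (k%:Z + m), k%:Z + m) | k <- iota 0 (size p)].

Lemma lfun_lmul s t z : z != 0 -> lfun (lmul s t) z = lfun s z * lfun t z.
Proof.
move=> z0; rewrite /lfun /lmul big_allpairs_dep big_distrl; apply: eq_bigr => x _.
by rewrite big_distrr; apply: eq_bigr => y _; rewrite expfzDr//= mulrACA.
Qed.

Lemma lfun_lscale lam s z : lfun (lscale lam s) z = lfun s (lam * z).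
Proof.
rewrite /lfun big_map; apply: eq_bigr => x _.
by rewrite expfzMl mulrA.
Qed.

Lemma conjcXz z (k : int) : conjc (z ^ k) = conjc z ^ k.
Proof. by case: k => n; rewrite ?NegzE -?exprnN -?exprnP ?conjc_inv rmorphXn. Qed.

Lemma lfun_lconj s z : lfun (lconj s) z = conjc (lfun s (conjc z^-1)).
Proof.
rewrite /lfun big_map rmorph_sum; apply: eq_bigr => x _ /=.
by rewrite rmorphM/= conjcXz conjcK exprz_inv.
Qed.

Lemma lfun_lpoly p m al z : al * z != 0 ->
  lfun (lpoly p m al) z = laurC p m (al * z).
Proof.
move=> z0; rewrite /lfun /laurC big_map.
rewrite -{1}(subn0 (size p)) -/(index_iota 0 (size p)) big_mkord.
rewrite horner_coef big_distrr; apply: eq_bigr => k _ /=.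
by rewrite -mulrA -expfzMl expfzDr// -exprnP [RHS]mulrCA (mulrC (_ ^ m)).
Qed.

(* Z^N times the Laurent polynomial [s], an ordinary polynomial when N is at least
   [lorder s]; for smaller N the exponents are junk. *)
Definition lnum (N : nat) s : {poly R[i]} :=
  \sum_(x <- s) x.1 *: 'X^(absz (x.2 + N%:Z)).

Definition lorder s : nat := \sum_(x <- s) absz x.2.

Lemma lorder_ge0 s x : x \in s -> 0 <= x.2 + (lorder s)%:Z.
Proof.
move=> xs; rewrite /lorder; have : (absz x.2 <= \sum_(y <- s) absz y.2)%N.
  elim: s xs => // y s IH; rewrite inE big_cons => /predU1P[->|/IH].
    exact: leq_addr.
  by move=> /leq_trans; apply; exact: leq_addl.
by move: (\sum_(_ <- s) _)%N => n; lia.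
Qed.

Lemma lfun_lnum s z : z != 0 ->
  (lnum (lorder s) s).[z] = lfun s z * z ^+ lorder s.
Proof.
move=> z0; rewrite /lnum horner_sum /lfun big_distrl big_seq [RHS]big_seq.
apply: eq_bigr => x /lorder_ge0 xb /=.
rewrite hornerZ hornerXn -mulrA (exprnP z (lorder s)) -expfzDr// exprnP.
by rewrite gez0_abs.
Qed.

Lemma lfun_lnum_eq0 s (E : seq R[i]) : uniq E ->
  (size (lnum (lorder s) s) <= size E)%N ->
  (forall z, z \in E -> z != 0 /\ lfun s z = 0) -> lnum (lorder s) s = 0.
Proof.
move=> uE sE Ez; apply/eqP; apply: contraTT sE => p0; rewrite -ltnNge.
apply: max_poly_roots => //; apply/allP => z /Ez[z0 sz].
by apply/rootP; rewrite lfun_lnum// sz mul0r.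
Qed.

End LaurentFunctions.

(** * Laurent polynomials evaluated at Z *)

Section LaurentElements.
Context {R : realType} {A : algType R[i]} {Z Zi : A}.
Context (ZZi : Z * Zi = 1) (ZiZ : Zi * Z = 1).
Implicit Types (s t : seq (R[i] * int)) (z lam : R[i]) (a b : A).

Definition lev s : A := \sum_(x <- s) x.1 *: Zpow Z Zi x.2.

Lemma ZpowS k : Zpow Z Zi (k + 1) = Z * Zpow Z Zi k.
Proof.
case: k => [n|[|n]].
- by rewrite -[Posz n + 1]/(Posz (n + 1)) addn1 /= exprS.
- by rewrite /= expr1 ZZi.
- have -> : Negz n.+1 + 1 = Negz n by lia.
  by rewrite /= [Zi ^+ n.+2]exprS mulrA ZZi mul1r.
Qed.

Lemma ZpowP k : Zpow Z Zi (k - 1) = Zi * Zpow Z Zi k.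
Proof. by rewrite -{2}(subrK 1 k) ZpowS mulrA ZiZ mul1r. Qed.

Lemma ZpowD j k : Zpow Z Zi (j + k) = Zpow Z Zi j * Zpow Z Zi k.
Proof.
elim/int_ind: j => [|n IH|n IH]; first by rewrite add0r mul1r.
- by rewrite -addn1 PoszD addrAC ZpowS IH ZpowS mulrA.
- have -> : - n.+1%:Z = - n%:Z - 1 by lia.
  by rewrite addrAC ZpowP IH ZpowP mulrA.
Qed.

Lemma levM s t : lev (lmul s t) = lev s * lev t.
Proof.
rewrite /lev /lmul big_allpairs_dep mulr_suml; apply: eq_bigr => x _.
rewrite mulr_sumr; apply: eq_bigr => y _.
by rewrite ZpowD -scalerAl -scalerAr scalerA.
Qed.

Lemma lev_lmulC s t : lev s * lev t = lev t * lev s.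
Proof.
rewrite /lev mulr_suml; under eq_bigr do rewrite mulr_sumr.
rewrite exchange_big mulr_suml; apply: eq_bigr => y _.
rewrite mulr_sumr; apply: eq_bigr => x _.
by rewrite -!scalerAl -!scalerAr !scalerA -!ZpowD addrC mulrC.
Qed.

Lemma lev1 : lev [:: (1, 0)] = 1.
Proof. by rewrite /lev big_seq1 scale1r. Qed.

Lemma lev_cat s t : lev (s ++ t) = lev s + lev t.
Proof. by rewrite /lev big_cat. Qed.

Lemma levZ k s : lev [seq (k * x.1, x.2) | x <- s] = k *: lev s.
Proof.
by rewrite /lev big_map scaler_sumr; apply: eq_bigr => x _; rewrite scalerA.
Qed.

Lemma lev_lpoly (p : {poly R[i]}) m al : lev (lpoly p m al) = laurA Z Zi p m al.
Proof.
rewrite /lev /laurA big_map.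
by rewrite -{1}(subn0 (size p)) -/(index_iota 0 (size p)) big_mkord.
Qed.

Lemma skew_Zpow a lam k : lam != 0 -> a * Z = lam *: (Z * a) ->
  a * Zpow Z Zi k = lam ^ k *: (Zpow Z Zi k * a).
Proof.
move=> l0 aZ; have aZi : a * Zi = lam^-1 *: (Zi * a).
  have -> : Zi * a = Zi * (a * Z) * Zi by rewrite -!mulrA ZZi mulr1.
  by rewrite aZ -scalerAr -scalerAl !mulrA ZiZ mul1r scalerA mulVf// scale1r.
elim/int_ind: k => [|n IH|n IH]; first by rewrite mulr1 mul1r scale1r.
- rewrite -addn1 PoszD ZpowS mulrA aZ -scalerAl -mulrA IH -scalerAr scalerA.
  by rewrite expfzDr// mulrC mulrA.
- have -> : - n.+1%:Z = - n%:Z - 1 by lia.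
  rewrite ZpowP mulrA aZi -scalerAl -mulrA IH -scalerAr scalerA.
  by rewrite expfzDr// mulrC mulrA.
Qed.

Lemma skew_lev a lam s : lam != 0 -> a * Z = lam *: (Z * a) ->
  a * lev s = lev (lscale lam s) * a.
Proof.
move=> l0 aZ; rewrite /lev big_map mulr_sumr mulr_suml; apply: eq_bigr => x _.
by rewrite -scalerAr (skew_Zpow _ _ _ l0 aZ) scalerA scalerAl.
Qed.

(** The zeros in E make the numerator the zero polynomial. Its value at [Z] is the element times a
    power of [Z], which is invertible. *)
Lemma lev_eq0 s (E : seq R[i]) : uniq E ->
  (size (lnum (lorder s) s) <= size E)%N ->
  (forall z, z \in E -> z != 0 /\ lfun s z = 0) -> lev s = 0.
Proof.
move=> uE sE Ez; have p0 := lfun_lnum_eq0 s E uE sE Ez.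
have : lev s * Zpow Z Zi (lorder s) = 0.
  have <- : horner_alg Z (lnum (lorder s) s) = lev s * Zpow Z Zi (lorder s).
    rewrite /lnum linear_sum /lev mulr_suml big_seq [RHS]big_seq.
    apply: eq_bigr => x /lorder_ge0 xb.
    rewrite linearZ_LR/= rmorphXn/= horner_algX -[RHS]scalerAl mulr_algl.
    by rewrite -[Z ^+ lorder s]/(Zpow Z Zi (lorder s)) -ZpowD -[in RHS](gez0_abs xb).
  by rewrite p0 rmorph0.
move=> /(congr1 (fun a => a * Zpow Z Zi (- (lorder s)%:Z))).
by rewrite mul0r -mulrA -ZpowD subrr mulr1.
Qed.

End LaurentElements.
Arguments lev {R A} Z Zi s.


(** * Reduction to degrees 0 and 1 *)

Section TwoGenerators.
Context {R : realType} {A : algType R[i]} {Z Zi : A}.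
Context (ZZi : Z * Zi = 1) (ZiZ : Zi * Z = 1).
(** Used with (x, y) = (u, v), lam = q^{-2} and with (x, y) = (v, u), lam = q^2, covering positive
    and negative degrees by one argument. Hypothesis [inj] is cancellation of the translates of xy;
    it will follow from the location of the roots. *)
Context (x y : A) (lam : R[i]) (sx sy : seq (R[i] * int)).
Context (lam0 : lam != 0) (xZ : x * Z = lam *: (Z * x))
  (yZ : y * Z = lam^-1 *: (Z * y)).
Context (xyE : x * y = lev Z Zi sx) (yxE : y * x = lev Z Zi sy).
Context (inj : forall n s,
  lev Z Zi (lmul s (lscale (lam ^+ n) sx)) = 0 -> lev Z Zi s = 0).
Local Notation lev := (lev Z Zi).

Lemma expr_lev n s : x ^+ n * lev s = lev (lscale (lam ^+ n) s) * x ^+ n.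
Proof.
apply: (skew_lev ZZi ZiZ); first by rewrite expf_neq0.
elim: n => [|n IH]; first by rewrite !expr0 mul1r scale1r mulr1.
by rewrite exprS -mulrA IH -scalerAr !mulrA xZ -!scalerAl scalerA !exprS mulrC.
Qed.

(** Right multiplication by y lowers the power of x by one at the cost of the factor sx(lam^n Z),
    which [inj] cancels. *)
Lemma lev_expr_inj n s : lev s * x ^+ n = 0 -> lev s = 0.
Proof.
elim: n s => [|n IH] s; first by rewrite mulr1.
move=> sx0; apply: (inj n); apply: IH.
rewrite (levM ZZi ZiZ) -mulrA -expr_lev -xyE !mulrA -(mulrA (lev s)).
by rewrite -exprSr sx0 mul0r.
Qed.

Lemma lscale1 s : lscale (1 : R[i]) s = s.
Proof.
by rewrite /lscale -[RHS]map_id; apply: eq_map => -[c k] /=; rewrite exp1rz mulr1.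
Qed.

(** Left multiplication by x replaces y by the degree 0 factor xy, and two cancellations follow. *)
Lemma lev_cross_inj n s : y * (lev s * x ^+ n) = 0 -> lev s = 0.
Proof.
move=> ys0; apply: (inj 0); rewrite lscale1; apply: (lev_expr_inj n).
by rewrite (levM ZZi ZiZ) (lev_lmulC ZZi ZiZ) -xyE -!mulrA ys0 mulr0.
Qed.

(** For b = s x^{n+1}, the swap turns the norm of s x^{n+2} into that of y s x^{n+1}, which has
    degree n because yx has degree 0. Nonvanishing survives by [lev_cross_inj]. *)
Lemma graded_pos (N : A -> R[i]) : (forall b, N (b * x) = N (y * b)) ->
  (forall s, lev s != 0 -> 0 < N (lev s)) ->
  (forall s, lev s * x != 0 -> 0 < N (lev s * x)) ->
  forall n s, lev s * x ^+ n != 0 -> 0 < N (lev s * x ^+ n).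
Proof.
move=> swap N0 N1 n s.
(* Strong induction, since each swap lowers the degree by two; degrees 0 and 1 are the base
   cases. *)
elim: n {-2}n (leqnn n) s => [|k IH] [|[|n]] // kn s sx0.
- by rewrite mulr1 in sx0 *; exact: N0.
- by rewrite mulr1 in sx0 *; exact: N0.
have E : y * (lev s * x ^+ n.+1) = lev (lmul (lscale lam^-1 s) sy) * x ^+ n.
  rewrite exprS !mulrA (skew_lev ZZi ZiZ _ _ _ _ yZ) ?invr_neq0//.
  by rewrite (levM ZZi ZiZ) -yxE !mulrA.
rewrite exprSr mulrA swap E; apply: IH; first by lia.
rewrite -E; apply: contra_neq sx0 => /lev_cross_inj ->.
by rewrite mul0r.
Qed.

End TwoGenerators.

(** * Decomposition into homogeneous elements *)

Section Grading.
Context {R : realType} {A : algType R[i]} {Z Zi u v : A} {q : R}.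
Context {p : {poly R[i]}} {m : int} (q0 : 0 < q) (AP : is_AP q p m u v Z Zi).
Local Notation lev := (lev Z Zi).

Let qC0 : q%:C != 0 :> R[i].
Proof. by rewrite (inj_eq (@complexI R)) gt_eqF. Qed.

Let ZZi : Z * Zi = 1. Proof. by case: AP => -[]. Qed.
Let ZiZ : Zi * Z = 1. Proof. by case: AP => -[]. Qed.

Lemma uZ : u * Z = (q%:C ^+ 2)^-1 *: (Z * u).
Proof.
have [[_ _ Zu _ _] _] := AP.
have -> : Z * u = (Z * u * Zi) * Z by rewrite -mulrA ZiZ mulr1.
by rewrite Zu -scalerAl scalerA mulVf ?expf_neq0// scale1r.
Qed.

Lemma vZ : v * Z = q%:C ^+ 2 *: (Z * v).
Proof.
have [[_ _ _ Zv _] _] := AP.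
have -> : Z * v = (Z * v * Zi) * Z by rewrite -mulrA ZiZ mulr1.
by rewrite Zv -scalerAl scalerA mulfV ?expf_neq0// scale1r.
Qed.

Lemma uvE : u * v = lev (lpoly p m (q%:C)^-1).
Proof. by have [[_ _ _ _ [-> _]] _] := AP; rewrite lev_lpoly. Qed.

Lemma vuE : v * u = lev (lpoly p m q%:C).
Proof. by have [[_ _ _ _ [_ ->]] _] := AP; rewrite lev_lpoly. Qed.

Definition hom_gen (i : int) : A :=
  match i with Posz n => u ^+ n | Negz n => v ^+ n.+1 end.

(** Degree [i] by an explicit normal form; [homogeneous_in_Ai] leads to the eigenvalue condition
    [in_Ai]. *)
Definition homogeneous (i : int) (a : A) := exists s, a = lev s * hom_gen i.

Lemma homogeneous0 i : homogeneous i 0.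
Proof. by exists [::]; rewrite /lev big_nil mul0r. Qed.

Lemma homogeneousD i a b : homogeneous i a -> homogeneous i b ->
  homogeneous i (a + b).
Proof. by move=> [s ->] [t ->]; exists (s ++ t); rewrite lev_cat mulrDl. Qed.

Lemma homogeneousZ i k a : homogeneous i a -> homogeneous i (k *: a).
Proof.
by move=> [s ->]; exists [seq (k * x.1, x.2) | x <- s]; rewrite levZ scalerAl.
Qed.

Lemma homogeneous_levM i t a : homogeneous i a -> homogeneous i (lev t * a).
Proof. by move=> [s ->]; exists (lmul t s); rewrite (levM ZZi ZiZ) mulrA. Qed.

Lemma homogeneous_uM i a : homogeneous i a -> homogeneous (i + 1) (u * a).
Proof.
have q2 : (q%:C ^+ 2)^-1 != 0 :> R[i] by rewrite invr_neq0// expf_neq0.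
move=> [s ->]; rewrite mulrA (skew_lev ZZi ZiZ _ _ _ q2 uZ) -mulrA.
apply: homogeneous_levM; case: i => [n|[|n]] /=.
- exists [:: (1, 0)]; rewrite -[Posz n + 1]/(Posz (n + 1)) addn1 /= -exprS.
  by rewrite lev1 mul1r.
- by rewrite uvE; exists (lpoly p m (q%:C)^-1); rewrite /= mulr1.
- have -> : Negz n.+1 + 1 = Negz n by lia.
  by rewrite exprS mulrA uvE; exists (lpoly p m (q%:C)^-1).
Qed.

Lemma homogeneous_vM i a : homogeneous i a -> homogeneous (i - 1) (v * a).
Proof.
have q2 : q%:C ^+ 2 != 0 :> R[i] by rewrite expf_neq0.
move=> [s ->]; rewrite mulrA (skew_lev ZZi ZiZ _ _ _ q2 vZ) -mulrA.
apply: homogeneous_levM; case: i => [[|n]|n] /=.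
- by exists [:: (1, 0)]; rewrite lev1 mul1r /= mulr1.
- have -> : Posz n.+1 - 1 = Posz n by lia.
  by rewrite exprS mulrA vuE; exists (lpoly p m q%:C).
- have -> : Negz n - 1 = Negz n.+1 by lia.
  by exists [:: (1, 0)]; rewrite lev1 mul1r /= -exprS.
Qed.

(** Degrees may repeat here, which makes closure under sums immediate; [hom_decomp] merges equal
    degrees. *)
Inductive hom_sum : A -> Prop :=
| hom_sum0 : hom_sum 0
| hom_sumD i a b : homogeneous i a -> hom_sum b -> hom_sum (a + b).

Lemma hom_sum_add a b : hom_sum a -> hom_sum b -> hom_sum (a + b).
Proof.
by elim=> [|i c d hc _ IH] hb; rewrite ?add0r// -addrA; apply: hom_sumD hc (IH hb).
Qed.

Lemma hom_sum_map (f : A -> A) (d : int -> int) : f 0 = 0 ->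
  (forall a b, f (a + b) = f a + f b) ->
  (forall i a, homogeneous i a -> homogeneous (d i) (f a)) ->
  forall a, hom_sum a -> hom_sum (f a).
Proof.
move=> f0 fD fh a; elim=> [|i b c hb _ IH]; first by rewrite f0; exact: hom_sum0.
by rewrite fD; apply: hom_sumD (fh _ _ hb) IH.
Qed.

(* The elements mapping [hom_sum] into itself by left multiplication form a
   subalgebra containing the generators. *)
Lemma hom_sumP a : hom_sum a.
Proof.
suff W b : hom_sum b -> hom_sum (a * b).
  rewrite -[a]mulr1; apply: W; rewrite -[1]addr0.
  by apply: (hom_sumD 0) hom_sum0; exists [:: (1, 0)]; rewrite lev1 mul1r.
move: b; apply: (is_AP_ind (fun a => forall b, hom_sum b -> hom_sum (a * b))
  _ _ _ _ _ _ _ _ _ _ _ AP) => {a}.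
- by move=> b; rewrite mul1r.
- by move=> a b ha hb c hc; rewrite mulrDl; apply: hom_sum_add; [exact: ha|exact: hb].
- move=> k a ha b hb; rewrite -scalerAl.
  by apply: (hom_sum_map _ id) (ha _ hb);
    [exact: scaler0|move=> *; exact: scalerDr|move=> *; exact: homogeneousZ].
- by move=> a b ha hb c hc; rewrite -mulrA; exact/ha/hb.
- by apply: (hom_sum_map _ (fun i => i + 1));
    [exact: mulr0|move=> *; exact: mulrDr|move=> *; exact: homogeneous_uM].
- by apply: (hom_sum_map _ (fun i => i - 1));
    [exact: mulr0|move=> *; exact: mulrDr|move=> *; exact: homogeneous_vM].
- apply: (hom_sum_map _ id); [exact: mulr0|move=> *; exact: mulrDr|move=> i a ha].
  have -> : Z * a = lev [:: (1, 1)] * a by rewrite /lev big_seq1 scale1r.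
  exact: homogeneous_levM.
- apply: (hom_sum_map _ id); [exact: mulr0|move=> *; exact: mulrDr|move=> i a ha].
  have -> : Zi * a = lev [:: (1, -1)] * a by rewrite /lev big_seq1 scale1r.
  exact: homogeneous_levM.
Qed.

Lemma hom_decomp a : exists (I : seq int) (f : int -> A),
  [/\ uniq I, (forall i, homogeneous i (f i)) & a = \sum_(i <- I) f i].
Proof.
elim: (hom_sumP a) => [|i b c hb _ [I [f [uI fh ->]]]].
  by exists [::], (fun=> 0); split => // [i|]; rewrite ?big_nil//; exact: homogeneous0.
(* The test guards against f i when i is not in I, where that value does not occur in the sum. *)
pose g j := if j == i then b + (if i \in I then f i else 0) else f j.
have gh j : homogeneous j (g j).
  rewrite /g; case: eqVneq => // ->; apply: homogeneousD => //.
  by case: ifP => // _; exact: homogeneous0.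
have [iI|iI] := boolP (i \in I).
  exists I, g; split => //; rewrite (bigD1_seq i)//= [in RHS](bigD1_seq i)//=.
  rewrite /g eqxx iI -addrA; congr (_ + (_ + _)).
  by apply: eq_bigr => j /negbTE ->.
exists (i :: I), g; split => //=; first by rewrite iI.
rewrite big_cons /g eqxx (negbTE iI) addr0; congr (_ + _).
by apply: eq_big_seq => j jI; case: eqVneq => // ji; rewrite -ji jI in iI.
Qed.

Lemma in_AiM i j a b : in_Ai q Z Zi i a -> in_Ai q Z Zi j b ->
  in_Ai q Z Zi (i + j) (a * b).
Proof.
rewrite /in_Ai => ha hb.
have -> : Z * (a * b) * Zi = (Z * a * Zi) * (Z * b * Zi).
  by rewrite -!mulrA (mulrA Zi Z) ZiZ mul1r.
by rewrite ha hb -scalerAl -scalerAr scalerA -expfzDr// mulrDr.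
Qed.

Lemma in_Ai_lev s : in_Ai q Z Zi 0 (lev s).
Proof.
rewrite /in_Ai mulr0 expr0z scale1r /lev mulr_sumr mulr_suml.
apply: eq_bigr => x _; rewrite -scalerAr -scalerAl -(ZpowS ZZi) (ZpowD ZZi ZiZ).
by rewrite -mulrA -[Zpow Z Zi 1]/(Z ^+ 1) expr1 ZZi mulr1.
Qed.

Lemma in_AiX i a n : in_Ai q Z Zi i a -> in_Ai q Z Zi (n%:Z * i) (a ^+ n).
Proof.
move=> ha; elim: n => [|n IH].
  by rewrite /in_Ai expr0 mulr1 ZZi mul0r mulr0 expr0z scale1r.
by rewrite exprS -addn1 PoszD mulrDl mul1r addrC; exact: in_AiM.
Qed.

Lemma homogeneous_in_Ai i a : homogeneous i a -> in_Ai q Z Zi i a.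
Proof.
have [[_ _ Zu Zv _] _] := AP.
have hu : in_Ai q Z Zi 1 u by rewrite /in_Ai Zu mulr1.
have hv : in_Ai q Z Zi (-1) v.
  by rewrite /in_Ai Zv mulrN1 -exprnN.
move=> [s ->]; rewrite -(add0r i); apply: in_AiM (in_Ai_lev s) _.
case: i => n /=; first by have := in_AiX _ _ n hu; rewrite mulr1.
by rewrite subn0 NegzE -(mulrN1 (n.+1%:Z)); exact: in_AiX.
Qed.

(** * The form defined by a twisted trace *)

Section Trace.
Context {g : A -> A} {rho : {rmorphism A -> A}} {T : A -> R[i]} {e t : R[i]}.
Context (rhoZ : forall (k : R[i]) a, rho (k *: a) = conjc k *: rho a).
Context (rho_u : rho u = e^-1 *: v) (rho_v : rho v = e *: u).
Context (rho_Z : rho Z = Zi) (rho_Zi : rho Zi = Z).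
Context (e0 : e != 0) (gZ : forall k a, g (k *: a) = k *: g a).
Context (g_u : g u = e ^+ 2 *: u) (g_v : g v = e ^- 2 *: v).
Context (TT : twisted_trace g T).
Context (T_graded : forall i a, i != 0 -> in_Ai q Z Zi i a -> T a = 0).

Lemma trace0 : T 0 = 0.
Proof.
have := TT.1 1 0 0; rewrite scaler0 addr0 mul1r => /eqP.
by rewrite -subr_eq0 opprD addNKr oppr_eq0 => /eqP.
Qed.

Lemma traceZ k a : T (k *: a) = k * T a.
Proof. by have := TT.1 k a 0; rewrite !addr0 trace0 addr0. Qed.

Lemma trace_sum (I : Type) (r : seq I) (f : I -> A) :
  T (\sum_(i <- r) f i) = \sum_(i <- r) T (f i).
Proof.
elim: r => [|i r IH]; first by rewrite !big_nil trace0.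
by rewrite !big_cons -IH -[f i]scale1r TT.1 mul1r scale1r.
Qed.

Lemma rho_lev s : rho (lev s) = lev (lconj s).
Proof.
rewrite /lev big_map rmorph_sum; apply: eq_bigr => x _ /=.
rewrite rhoZ; congr (_ *: _); case: x.2 => [[|n]|n].
- exact: rmorph1.
- exact: etrans (rmorphXn rho n.+1 Z) (congr1 (fun z => z ^+ n.+1) rho_Z).
- exact: etrans (rmorphXn rho n.+1 Zi) (congr1 (fun z => z ^+ n.+1) rho_Zi).
Qed.

(** Since t = e^2, rho v = e u is also g(e^{-1} u). The twisted trace property carries this last
    factor to the front, and the scalar e^{-1} is the one in rho u = e^{-1} v. *)
Lemma trace_swap_v b : T (b * v * rho (b * v)) = T (u * b * rho (u * b)).
Proof.
have gu : g (e^-1 *: u) = rho v.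
  by rewrite gZ g_u scalerA rho_v expr2 mulKf.
rewrite rmorphM -gu mulrA -TT.2 rmorphM rho_u.
by rewrite -!scalerAl -!scalerAr !traceZ !mulrA.
Qed.

Lemma trace_swap_u b : T (b * u * rho (b * u)) = T (v * b * rho (v * b)).
Proof.
have gv : g (e *: v) = rho u.
  by rewrite gZ g_v scalerA rho_u expr2 invfM mulVKf.
rewrite rmorphM -gv mulrA -TT.2 rmorphM rho_v.
by rewrite -!scalerAl -!scalerAr !traceZ !mulrA.
Qed.

Lemma in_Ai_rho i a : in_Ai q Z Zi i a -> in_Ai q Z Zi (- i) (rho a).
Proof.
rewrite /in_Ai => /(congr1 rho); rewrite !rmorphM rhoZ rho_Z rho_Zi conjcXz.
rewrite conjc_real => ha.
have -> : Z * rho a * Zi = (q%:C ^ (2 * i))^-1 *: (Z * (q%:C ^ (2 * i) *: rho a) * Zi).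
  by rewrite -scalerAr -scalerAl scalerA mulVf ?scale1r ?expfz_neq0.
by rewrite -ha !mulrA ZZi mul1r -mulrA ZZi mulr1 mulrN invr_expz.
Qed.

(** A cross term of degrees i and j lies in degree i - j, where T vanishes unless i = j. *)
Lemma trace_homogeneous (I : seq int) (f : int -> A) : uniq I ->
  (forall i, homogeneous i (f i)) ->
  T ((\sum_(i <- I) f i) * rho (\sum_(i <- I) f i)) =
  \sum_(i <- I) T (f i * rho (f i)).
Proof.
move=> uI fh; rewrite rmorph_sum mulr_suml trace_sum.
apply: eq_big_seq => i iI; rewrite mulr_sumr trace_sum (bigD1_seq i)//=.
rewrite [X in _ + X]big1_seq ?addr0// => j /andP[ji _].
apply: (T_graded (i - j)); first by rewrite subr_eq0 eq_sym.
by apply: in_AiM; [|apply: in_Ai_rho]; exact: homogeneous_in_Ai.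
Qed.

Context (inj : forall (n : nat) s,
  (lev (lmul s (lscale ((q%:C ^- 2) ^+ n) (lpoly p m (q%:C)^-1))) = 0 ->
     lev s = 0) /\
  (lev (lmul s (lscale ((q%:C ^+ 2) ^+ n) (lpoly p m q%:C))) = 0 ->
     lev s = 0)).
Context (T0 : forall s, lev s != 0 -> 0 < T (lev s * rho (lev s))).
Context (T1 : forall s, lev s * u != 0 -> 0 < T (lev s * u * rho (lev s * u))).

Lemma positive_of_low_degrees : positive_trace rho T.
Proof.
have qi : q%:C ^- 2 != 0 :> R[i] by rewrite invr_neq0 ?expf_neq0.
have q2 : q%:C ^+ 2 != 0 :> R[i] by rewrite expf_neq0.
have vZ' : v * Z = (q%:C ^- 2)^-1 *: (Z * v) by rewrite invrK vZ.
have inju n s := (inj n s).1; have injv n s := (inj n s).2.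
pose N a := T (a * rho a).
(* Degree -1 reduces to degree 1: r v has the norm of u r, and u r = r(q^{-2} Z) u. *)
have Nv r : lev r * v != 0 -> 0 < N (lev r * v).
  move=> rv; have -> : N (lev r * v) = N (u * lev r) := trace_swap_v (lev r).
  have ur : u * lev r != 0.
    apply: contra_neq rv => ur.
    have := lev_cross_inj ZZi ZiZ v u (q%:C ^+ 2) _ q2 vZ vuE injv 0 r.
    by rewrite expr0 mulr1 => -> //; rewrite mul0r.
  by move: ur; rewrite (skew_lev ZZi ZiZ _ _ _ qi uZ); exact: T1.
have hpos i a : homogeneous i a -> a != 0 -> 0 < N a.
  move=> [s ->]; case: i => n.
    exact: (graded_pos ZZi ZiZ u v (q%:C ^- 2) _ _ qi uZ vZ' uvE vuE inju
      N trace_swap_u T0 T1 n s).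
  exact: (graded_pos ZZi ZiZ v u (q%:C ^+ 2) _ _ q2 vZ uZ vuE uvE injv
    N trace_swap_v T0 Nv n.+1 s).
move=> a a0; have [I [f [uI fh aE]]] := hom_decomp a.
rewrite aE trace_homogeneous//.
have f_ge0 i : 0 <= T (f i * rho (f i)).
  have [->|fi0] := eqVneq (f i) 0; last exact/ltW/(hpos i).
  by rewrite mul0r trace0.
have [i iI fi0] : exists2 i, i \in I & f i != 0.
  apply/hasP; rewrite -[has _ _]negbK -all_predC; apply: contra_neqN a0 => /allP f0.
  by rewrite aE big1_seq// => i /andP[_ /f0]; rewrite /= negbK => /eqP.
rewrite (bigD1_seq i)//=; apply: ltr_wpDr; last exact: (hpos i).
by apply: sumr_ge0.
Qed.

End Trace.
End Grading.


(** * Fourier analysis on the circle *)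

Section CircleExponential.
Context {R : realType}.
Implicit Types (z : R[i]) (x y a b : R).

Definition ez z : R[i] := cexp (2%:R * pi%:C * iC * z).

Lemma ezD z1 z2 : ez (z1 + z2) = ez z1 * ez z2.
Proof. by rewrite /ez mulrDr cexpD. Qed.

Lemma ez_neq0 z : ez z != 0.
Proof. exact: cexp_neq0. Qed.

Lemma ezN z : ez (- z) = (ez z)^-1.
Proof. by rewrite /ez mulrN cexpN. Qed.

Lemma ezE x y : ez (x +i* y) =
  (expR (- (2 * pi * y)))%:C * (cos (2 * pi * x) +i* sin (2 * pi * x)).
Proof.
rewrite /ez; have -> : 2%:R * pi%:C * iC * (x +i* y) =
    (- (2 * pi * y)) +i* (2 * pi * x) :> R[i].
  by apply/eqP; rewrite eq_complex /=; apply/andP; split; apply/eqP; ring.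
by [].
Qed.

Lemma ez_real x : ez x%:C = cos (2 * pi * x) +i* sin (2 * pi * x).
Proof. by rewrite ezE mulr0 oppr0 expR0 mul1r. Qed.

Lemma nr_ez_real x : nr (ez x%:C) = 1.
Proof. by rewrite ez_real /nr/= cos2Dsin2 sqrtr1. Qed.

Lemma ez_conj x : conjc (ez x%:C) = (ez x%:C)^-1.
Proof.
rewrite -ezN ez_real -rmorphN/= ez_real mulrN cosN sinN.
by apply/eqP; rewrite eq_complex /= !eqxx.
Qed.

Lemma ez1 z : ez (z + 1) = ez z.
Proof.
rewrite ezD [ez 1](ez_real 1) mulr1 [2 * pi]mulrC mulr_natr cos2pi sin2pi.
by rewrite [_ +i* _]/(1 : R[i]) mulr1.
Qed.

(** Equal values give cos(2 pi |x - y|) = 1 with argument in [0, pi], where cos is injective. *)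
Lemma ez_inj_small z x y : `|x - y| <= 1 / 2 ->
  ez (z + x%:C) = ez (z + y%:C) -> x = y.
Proof.
move=> xy; rewrite !ezD => /(mulfI (ez_neq0 z)) /eqP.
rewrite -subr_eq0 -[ez x%:C](mulfVK (ez_neq0 y%:C)) -[X in _ - X]mul1r -mulrBl.
rewrite mulf_eq0 (negbTE (ez_neq0 _)) orbF subr_eq0 -ezN -ezD -rmorphN -rmorphD/=.
rewrite ez_real eq_complex/= => /andP[/eqP c1 _].
have pi0 := pi_gt0 R; have n0 := normr_ge0 (x - y).
have : 2 * pi * `|x - y| = 0.
  apply: cos_inj; rewrite ?in_itv/= ?lexx ?pi_ge0//; first by nra.
  have pi2 : 0 < 2 * pi :> R by lra.
  by rewrite cos0; apply: etrans c1; rewrite -[RHS]cos_norm normrM (gtr0_norm pi2).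
move/eqP; rewrite mulf_eq0 gt_eqF/=; last lra.
by rewrite normr_eq0 subr_eq0 => /eqP.
Qed.

Lemma ccont_ez z x : ccont (fun t => ez (z + t%:C)) x.
Proof.
have -> : (fun t => ez (z + t%:C)) =
    (fun t => cexp (2%:R * pi%:C * iC * z + t%:C * (2%:R * pi%:C * iC))).
  by apply/funext => t; rewrite /ez; congr cexp; ring.
by apply: ccont_line; exact: cdiff_cexp.
Qed.

Lemma ccont_ez0 x : ccont (fun t => ez t%:C) x.
Proof. by have := ccont_ez 0 x; under eq_fun do rewrite add0r. Qed.

Lemma cdiff_ezXz (k : int) z : cdiff (fun y : R[i] => ez y ^ k) z.
Proof.
have -> : (fun y : R[i] => ez y ^ k) =
   (fun y : R[i] => cexp ((k%:~R * (2%:R * pi%:C * iC)) * y + 0)).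
  apply/funext => y; rewrite /ez -cexpMz addr0; congr cexp.
  by rewrite !mulrA.
by apply: cdiff_affine; exact: cdiff_cexp.
Qed.

Lemma ccont_lfun s (f : R -> R[i]) x : f x != 0 -> ccont f x ->
  ccont (fun t => lfun s (f t)) x.
Proof.
move=> f0 fx; apply: ccont_sum => k; apply: ccontM; first exact: ccont_cst.
exact: ccontXz.
Qed.

Lemma ccont_conj (f : R -> R[i]) x : ccont f x -> ccont (fun t => conjc (f t)) x.
Proof.
move=> [fr fi]; split.
  have -> // : (fun t => complex.Re (conjc (f t))) = (fun t => complex.Re (f t)).
  by apply/funext => t; case: (f t).
have -> : (fun t => complex.Im (conjc (f t))) = (fun t => - complex.Im (f t)).
  by apply/funext => t; case: (f t).
exact: continuousN.
Qed.

Lemma mul_conjc_real (z : R[i]) : z * conjc z = (nr z ^+ 2)%:C.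
Proof. by rewrite -sqr_normc nrE rmorphXn. Qed.

(* The kernel [peak y ^+ n] is the square modulus of ((1 + Z / e(y)) / 2)^n. *)
Fixpoint peak_root (y : R) (n : nat) : seq (R[i] * int) :=
  if n is n'.+1 then
    lmul [:: ((1 / 2)%:C, 0); ((1 / 2)%:C * (ez y%:C)^-1, 1)] (peak_root y n')
  else [:: (1, 0)].

Lemma peak_rootE y n x : lfun (peak_root y n) (ez x%:C) *
  conjc (lfun (peak_root y n) (ez x%:C)) = (peak y x ^+ n)%:C.
Proof.
elim: n => [|n IH].
  by rewrite mul_conjc_real /lfun big_seq1 /= expr0z mulr1 nr1 expr1n.
have -> : peak_root y n.+1 =
  lmul [:: ((1 / 2)%:C, 0); ((1 / 2)%:C * (ez y%:C)^-1, 1)] (peak_root y n) by [].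
rewrite (lfun_lmul _ _ _ (ez_neq0 _)) [conjc _]rmorphM mulrACA IH exprS [in RHS]rmorphM/=.
congr (_ * _); rewrite /peak.
set C := cos _; set D := sin (2 * pi * (x - y)).
have CD : C ^+ 2 + D ^+ 2 = 1 by exact: cos2Dsin2.
have Exy : (ez y%:C)^-1 * ez x%:C = C +i* D.
  by rewrite -ezN -ezD addrC -rmorphN -rmorphD ez_real.
have -> : lfun [:: ((1 / 2)%:C, 0); ((1 / 2)%:C * (ez y%:C)^-1, 1)] (ez x%:C) =
    ((1 + C) / 2) +i* (D / 2).
  rewrite /lfun !big_cons big_nil /fst /snd expr0z expr1z -mulrA Exy.
  by apply/eqP; rewrite eq_complex /=; apply/andP; split; apply/eqP; ring.
apply/eqP; rewrite eq_complex /=; apply/andP; split; apply/eqP; last by ring.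
by move: CD; rewrite !expr2; lra.
Qed.

(** The integral of |R(lam z)|^2 f over the circle; lam = 1 arises in degree 0 and lam = q in degree
    1. *)
Definition sqint (lam : R[i]) (f : R -> R[i]) s : R[i] := cint 0 1 (fun x =>
  lfun s (lam * ez x%:C) * conjc (lfun s (lam * ez x%:C)) * f x).

(** Nonnegativity in [R[i]] includes being real, so the kernel lemma is applied to Re f, Im f and -
    Im f. *)
Lemma sqint_ge0 f : ccseg 0 1 f -> (forall s, 0 <= sqint 1 f s) ->
  forall x, 0 <= x <= 1 -> 0 <= f x.
Proof.
move=> fc fs; have fr := ccseg_Re _ _ _ fc; have fi := ccseg_Im _ _ _ fc.
have E n y : sqint 1 f (peak_root y n) = cint 0 1 (fun x => (peak y x ^+ n)%:C * f x).
  by apply: eq_cint => x _; rewrite mul1r peak_rootE.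
have r (n : nat) (y : R) : 0 <= rint 0 1 (fun x => peak y x ^+ n * complex.Re (f x)) /\
    rint 0 1 (fun x => peak y x ^+ n * complex.Im (f x)) = 0.
  have := fs (peak_root y n); rewrite E lecE Re_cint Im_cint => /andP[/eqP i0 r0].
  split.
    move: r0; congr (_ <= _); apply: eq_rint => x _.
    by case: (f x) => ? ? /=; ring.
  rewrite -[RHS]i0; apply: eq_rint => x _.
  by case: (f x) => ? ? /=; ring.
have rN (n : nat) (y : R) : 0 <= rint 0 1 (fun x => peak y x ^+ n * - complex.Im (f x)).
  rewrite (@eq_rint _ _ _ _ (fun t => -1 * (peak y t ^+ n * complex.Im (f t)))).
    rewrite rintZ; first by have [_ ->] := r n y; rewrite mulr0.
    by move=> t /fi ft; apply: continuousM => //; exact: peak_continuous.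
  by move=> t _; ring.
have ri (n : nat) (y : R) : 0 <= rint 0 1 (fun x => peak y x ^+ n * complex.Im (f x)).
  by have [_ ->] := r n y.
have fiN : cseg 0 1 (fun x => - complex.Im (f x)).
  by move=> t /fi ft; exact: continuousN.
move=> x hx; rewrite lecE eq_le -andbA; apply/and3P; split.
- have := peak_kernel_ge0 _ fiN rN x hx; by rewrite oppr_ge0.
- exact: (peak_kernel_ge0 _ fi ri x hx).
- exact: (peak_kernel_ge0 _ fr (fun n y => (r n y).1) x hx).
Qed.

Lemma ccseg_sq a b s lam f : lam != 0 -> ccseg a b f -> ccseg a b (fun x =>
  lfun s (lam * ez x%:C) * conjc (lfun s (lam * ez x%:C)) * f x).
Proof.
move=> l0 fc x hx; apply: ccontM; last exact: fc.
suff lc : ccont (fun x => lfun s (lam * ez x%:C)) x.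
  by apply: ccontM => //; exact: ccont_conj.
apply: ccont_lfun; first by rewrite mulf_neq0// ez_neq0.
by apply: ccontM; [exact: ccont_cst|exact: ccont_ez0].
Qed.

(** On the circle |R|^2 is itself a Laurent polynomial, so all square integrals of f and of - f
    vanish and both functions are nonnegative. *)
Lemma fourier_eq0 f : ccseg 0 1 f ->
  (forall s, cint 0 1 (fun x => lfun s (ez x%:C) * f x) = 0) ->
  forall x, 0 <= x <= 1 -> f x = 0.
Proof.
move=> fc fs; have f0 s : sqint 1 f s = 0.
  rewrite -(fs (lmul s (lconj s))); apply: eq_cint => x _.
  have Ex : conjc (ez x%:C)^-1 = ez x%:C.
    by rewrite -ezN -rmorphN ez_conj rmorphN ezN invrK.
  by rewrite (lfun_lmul _ _ _ (ez_neq0 _)) lfun_lconj Ex mul1r.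
have fN : ccseg 0 1 (fun x => -1 * f x).
  by move=> x /fc; exact: (ccontM _ _ _ (ccont_cst _ _)).
move=> x hx; apply/eqP; rewrite eq_le.
rewrite (sqint_ge0 f) ?andbT// => [|s]; last by rewrite f0.
rewrite -oppr_ge0 -mulN1r; apply: (sqint_ge0 _ fN) => // s.
have -> : sqint 1 (fun t => -1 * f t) s = -1 * sqint 1 f s.
  rewrite -cintZ; first by apply: eq_cint => t _; ring.
  by apply: ccseg_sq => //; exact: oner_neq0.
by rewrite f0 mulr0.
Qed.

Lemma cint_ge0 (f : R -> R[i]) : (forall x, 0 <= x <= 1 -> 0 <= f x) ->
  0 <= cint 0 1 f.
Proof.
move=> f0; rewrite lecE Re_cint Im_cint.
rewrite (@eq_rint _ _ _ (fun x => complex.Im (f x)) (fun=> 0)); last first.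
  by move=> x /f0 fx; rewrite (ger0_Im fx).
rewrite rint_cst// mul0r eqxx/=; apply: Rintegral_ge0 => x /=.
by rewrite in_itv/= => /f0; rewrite lecE => /andP[].
Qed.

(** As 0 <= peak^n <= 1, the integrals of peak^n f are squeezed to 0, so the kernel lemma applies to
    - f. *)
Lemma cint_ge0_eq0 (f : R -> R[i]) : ccseg 0 1 f ->
  (forall x, 0 <= x <= 1 -> 0 <= f x) -> cint 0 1 f = 0 ->
  forall x, 0 <= x <= 1 -> f x = 0.
Proof.
move=> fc f0 If x hx; have fr := ccseg_Re _ _ _ fc.
have := f0 x hx; rewrite lecE => /andP[/eqP i0 r0].
suff : 0 <= - complex.Re (f x).
  move: i0 r0; case: (f x) => a b /= -> a0; rewrite oppr_ge0 => a0'.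
  by have -> : a = 0 by apply/eqP; rewrite eq_le a0'.
have frN : cseg 0 1 (fun t => - complex.Re (f t)).
  by move=> t /fr ft; exact: continuousN.
apply: (fun H => peak_kernel_ge0 _ frN H x hx) => n y.
have pc t : {for t, continuous (fun x => peak y x ^+ n)}.
  exact: peak_continuous.
rewrite (@eq_rint _ _ _ _
    (fun t => -1 * (peak y t ^+ n * complex.Re (f t)))); last by move=> t _; ring.
have gc : cseg 0 1 (fun t => peak y t ^+ n * complex.Re (f t)).
  by move=> t /fr ft; exact: continuousM.
rewrite rintZ// mulN1r oppr_ge0 -[leRHS](_ : rint 0 1 (fun t => complex.Re (f t)) = 0).
  apply: le_rint => // t /f0; rewrite lecE => /andP[_ ft].
  rewrite ler_piMl// exprn_ile1 ?peak_ge0// /peak.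
  by have := cos_le1 (2 * pi * (t - y)); lra.
by rewrite -Re_cint If.
Qed.

(* The interval does not depend on the Laurent polynomial. *)
Lemma sqint_vanish f : ccseg 0 1 f -> (forall x, 0 <= x <= 1 -> 0 <= f x) ->
  (exists2 x, 0 <= x <= 1 & f x != 0) ->
  exists a b, [/\ a < b, b - a <= 1 / 2 &
    forall lam s, lam != 0 -> sqint lam f s = 0 ->
    forall x, a <= x <= b -> lfun s (lam * ez x%:C) = 0].
Proof.
move=> fc f0 [x0 hx0 fx0].
have N0 : 0 < nr (f x0) by rewrite lt_neqAle eq_sym nr_eq0 fx0 nr_ge0.
have [d d0 fd] := ccont_eps _ _ (fc _ hx0) _ N0.
pose r := Num.min d 1 / 4.
have r0 : 0 < r by rewrite divr_gt0// lt_min d0 ltr01.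
have [rd r1] : 4 * r <= d /\ 4 * r <= 1.
  have -> : 4 * r = Num.min d 1 by rewrite /r; lra.
  by rewrite !ge_min !lexx orbT.
have [a [ha ha']] : exists a, 0 <= a /\ a + r <= 1 /\
    forall x, a <= x <= a + r -> `|x - x0| < d.
  have [h|h] := leP x0 (1/2).
    by exists x0; split; [lra|split; [lra|move=> x hx; rewrite ltr_norml; lra]].
  by exists (x0 - r); split; [lra|split; [lra|move=> x hx; rewrite ltr_norml; lra]].
have {ha'} [har had] := ha'.
exists a, (a + r); split; [lra|lra|move=> lam s l0 I0 x hx].
have hx1 : 0 <= x <= 1 by lra.
have fx : f x != 0.
  apply/eqP => fx; have := fd x (had x hx).
  by rewrite fx sub0r nrN ltxx.
have := cint_ge0_eq0 _ (ccseg_sq 0 1 s lam f l0 fc) _ I0 x hx1.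
have pos t : 0 <= t <= 1 ->
    0 <= lfun s (lam * ez t%:C) * conjc (lfun s (lam * ez t%:C)) * f t.
  by move=> /f0 ft; rewrite mulr_ge0// mul_conjc_real lecR sqr_ge0.
move=> /(_ pos) /eqP; rewrite mulf_eq0 (negbTE fx) orbF mulf_eq0.
by rewrite conjc_eq0 orbb => /eqP.
Qed.

Lemma sqint_pos_ge0 lam f s : (forall x, 0 <= x <= 1 -> 0 <= f x) ->
  0 <= sqint lam f s.
Proof.
move=> f0; apply: cint_ge0 => x /f0 fx.
by rewrite mulr_ge0// mul_conjc_real lecR sqr_ge0.
Qed.

(** An interval of length at most 1/2 is mapped injectively to the circle, so it provides as many
    distinct zeros as the numerator has coefficients. *)
Lemma lev_vanish {A : algType R[i]} {Z Zi : A} lam s a b :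
  Z * Zi = 1 -> Zi * Z = 1 -> lam != 0 ->
  a < b -> b - a <= 1 / 2 ->
  (forall x, a <= x <= b -> lfun s (lam * ez x%:C) = 0) -> lev Z Zi s = 0.
Proof.
move=> ZZi ZiZ l0 ab ab2 H.
pose n := size (lnum (lorder s) s).
(* The denominator n + 1 stays nonzero when the numerator is the zero polynomial. *)
pose pt (k : nat) : R := a + (b - a) * (k%:R / n.+1%:R).
have n0 : 0 < n.+1%:R :> R by rewrite ltr0n.
have ptab k : (k < n)%N -> a <= pt k <= b.
  move=> kn; rewrite /pt lerDl mulr_ge0 ?divr_ge0//=; last by rewrite subr_ge0 ltW.
  rewrite -lerBrDl ler_piMr ?subr_ge0 ?(ltW ab)// ler_pdivrMr// mul1r ler_nat.
  exact: leqW (ltnW kn).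
apply: (lev_eq0 ZZi ZiZ s [seq lam * ez (pt k)%:C | k <- iota 0 n]).
- rewrite map_inj_in_uniq ?iota_uniq// => i j; rewrite !mem_iota /= !add0n => hi hj.
  move=> /(mulfI l0) eij; have [hi' hj'] := (ptab _ hi, ptab _ hj).
  have := ez_inj_small 0 (pt i) (pt j); rewrite !add0r => /(_ _ eij) pij.
  have {}pij : pt i = pt j by apply: pij; rewrite ler_norml; lra.
  move: pij => /addrI /(mulfI _) pij.
  have /pij : b - a != 0 by rewrite subr_eq0 gt_eqF.
  move=> /(congr1 (fun x => x * n.+1%:R)).
  by rewrite !mulfVK ?gt_eqF// => /eqP; rewrite eqr_nat => /eqP.
- by rewrite size_map size_iota.
- move=> z /mapP[k]; rewrite mem_iota add0n => kn ->.
  by rewrite mulf_neq0 ?ez_neq0// H// ptab.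
Qed.

End CircleExponential.


(** * The weight function on the strip *)

Section RightGerms.
Context {R : realType}.

(** Properties valid for all small d > 0. Moving a point to z + d avoids S and the zeros of P while
    staying on its horizontal line. *)
Definition right_ev (Q : R -> Prop) :=
  exists2 r : R, 0 < r & forall d, 0 < d < r -> Q d.

Lemma right_evI Q1 Q2 : right_ev Q1 -> right_ev Q2 ->
  right_ev (fun d => Q1 d /\ Q2 d).
Proof.
move=> [r1 r10 H1] [r2 r20 H2]; exists (Num.min r1 r2).
  by rewrite lt_min r10.
by move=> d; rewrite lt_min => /andP[d0 /andP[d1 d2]]; split; [apply: H1|apply: H2];
  rewrite d0.
Qed.

Lemma right_evS (Q1 Q2 : R -> Prop) : (forall d, Q1 d -> Q2 d) ->
  right_ev Q1 -> right_ev Q2.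
Proof. by move=> H [r r0 Hr]; exists r => // d /Hr /H. Qed.

Lemma right_ev_lt (e : R) : 0 < e -> right_ev (fun d => 0 < d < e).
Proof. by move=> e0; exists e. Qed.

Lemma right_ev_ex Q : right_ev Q -> exists2 d : R, 0 < d & Q d.
Proof. by move=> [r r0 H]; exists (r / 2); [lra|apply: H; lra]. Qed.

Lemma right_ev_near (Q : R[i] -> Prop) (z : R[i]) (e : R) : 0 < e ->
  (forall y, nr (y - z) < e -> y != z -> Q y) ->
  right_ev (fun d => Q (z + d%:C)).
Proof.
move=> e0 H; exists e => // d /andP[d0 de].
apply: H; first by rewrite addrC addKr nr_real gtr0_norm.
by rewrite -subr_eq0 addrC addKr (inj_eq (@complexI R) d 0) gt_eqF.
Qed.

(** Each of the finitely many roots is met at most once by z + d with 0 < d < 1/2; below that value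
    of d it is not met at all. *)
Lemma right_ev_poly (p : {poly R[i]}) z : p != 0 ->
  right_ev (fun d => p.[ez (z + d%:C)] != 0).
Proof.
move=> p0; have [rs ->] := closed_field_poly_normal p.
have lc : lead_coef p != 0 by rewrite lead_coef_eq0.
suff: right_ev (fun d => ez (z + d%:C) \notin rs).
  apply: right_evS => d; apply: contraNN.
  by rewrite hornerZ mulf_eq0 (negbTE lc) -[_ == 0]/(root _ _) root_prod_XsubC.
elim: rs => [|r rs IH]; first by exists 1.
suff : right_ev (fun d => ez (z + d%:C) != r).
  move=> /right_evI /(_ IH); apply: right_evS => d [d1 d2].
  by rewrite inE negb_or d1.
have [[d [/andP[d0 d1] dr]]|H] :=
    pselect (exists d, 0 < d < 1 / 2 /\ ez (z + d%:C) = r); last first.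
  exists (1 / 2); first by lra.
  by move=> d hd; apply/eqP => dr; apply: H; exists d.
exists d => // d' hd'; apply/eqP => dr'.
have := ez_inj_small z d d' _ (etrans dr (esym dr')).
by rewrite ler_norml => /(_ _); lra.
Qed.

End RightGerms.

(** * Periodicity, contour shift and non-vanishing on the strip *)

Section Strip.
Context {R : realType} {q : R} {tau : R[i]} {p : {poly R[i]}} {m : int}.
Context {w h : R[i] -> R[i]} {S : set R[i]} {U : set (R[i])^o} {t : R[i]}.
Context (Re_tau : complex.Re tau = 0)
  (Im_tau : 0 < complex.Im tau) (q_tau : q%:C = cexp (pi%:C * iC * tau)).
Context (p0 : p != 0) (mero : meromorphic w S).
Context (w_neq0 : exists z, ~ S z /\ w z != 0) (t0 : t != 0).
Context (w1 : forall z, ~ S z -> ~ S (z + 1) -> w (z + 1) = w z).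
Context (wtau : forall z, ~ S z -> ~ S (z + tau) -> w (z + tau) = t * w z).
Context (openU : open U) (parU : parallelogram tau `<=` U).
Context (holo_h : forall z : R[i], U z -> holo_at h z).
Context (hE : forall z : R[i], U z -> ~ S (z + tau / 2%:R) ->
     h z = w (z + tau / 2%:R) * laurC p m (ez z)).
Context (realS : forall x : R, ~ S x%:C).

Let sg := complex.Im tau.

Let tauE : tau = 0 +i* sg.
Proof. by rewrite /sg -Re_tau; case: tau. Qed.

Let tau2E : tau / 2%:R = 0 +i* (sg / 2).
Proof.
have -> : (2%:R : R[i]) = (2%:R : R)%:C by rewrite rmorph_nat.
by rewrite -fmorphV tauE; apply/eqP; rewrite eq_complex /=; apply/andP;
  split; apply/eqP; ring.
Qed.

Lemma q_expR : q = expR (- (pi * sg)).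
Proof.
apply: complexI; rewrite q_tau tauE.
have -> : pi%:C * iC * (0 +i* sg) = - (pi * sg) +i* 0 :> R[i].
  by apply/eqP; rewrite eq_complex /=; apply/andP; split; apply/eqP; ring.
by rewrite /cexp /= cos0 sin0 [_ +i* _]/(1 : R[i]) mulr1.
Qed.

Lemma ez_bottom x : ez (x +i* (- (sg / 2))) = (q%:C)^-1 * ez x%:C.
Proof.
rewrite ezE ez_real -fmorphV q_expR -expRN; congr ((expR _)%:C * _).
by field.
Qed.

Lemma strip_in_U x y : 0 <= x <= 1 -> - (sg / 2) <= y <= sg / 2 -> U (x +i* y).
Proof.
move=> hx /andP[y1 y2]; apply: parU; exists x, (y / sg); split => //.
  rewrite -[- (1 / 2)]mulNr ler_pdivlMr// ler_pdivrMr//; lra.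
have sg0 : sg != 0 by rewrite gt_eqF.
by rewrite tauE; apply/eqP; rewrite eq_complex /=; apply/andP; split;
  apply/eqP; field.
Qed.

Lemma cdiff_h z : U z -> cdiff h z.
Proof. by move=> /holo_h /holo_cdiff. Qed.

Lemma cdiff_w z : ~ S z -> cdiff w z.
Proof. by have [_ H _] := mero; move=> /H /holo_cdiff. Qed.

Lemma right_ev_S z : right_ev (fun d => ~ S (z + d%:C)).
Proof.
have [H _ _] := mero; have [e [e0 He]] := H z.
by apply: (right_ev_near (fun y => ~ S y) z e e0) => y; rewrite -ltcR; exact: He.
Qed.

Lemma right_ev_U z : U z -> right_ev (fun d => U (z + d%:C)).
Proof.
move=> Uz; have : nbhs (z : (R[i])^o) U by exact: open_nbhs_nbhs.
move=> /nbhs_ballP[e /= e0 He].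
have er : e = (complex.Re e)%:C by rewrite RRe_real// gtr0_real.
apply: (right_ev_near U z (complex.Re e)); first by rewrite -ltcR -er.
move=> y yz _; apply: He; rewrite /ball/= distrC er nrE ltcR//.
Qed.

(** The formula for h may fail at z and z + 1 themselves. It holds at z + d and z + 1 + d, which lie
    in U because U is open, and continuity of h gives the limit. *)
Lemma h_periodic y : - (sg / 2) <= y <= sg / 2 -> h (1 +i* y) = h (0 +i* y).
Proof.
move=> hy; pose z : R[i] := 0 +i* y.
have z1 : 1 +i* y = z + 1.
  by apply/eqP; rewrite eq_complex /=; apply/andP; split; apply/eqP; ring.
have U0 : U z by apply: strip_in_U => //; lra.
have U1 : U (z + 1) by rewrite -z1; apply: strip_in_U => //; lra.
rewrite z1 -/z; apply/eqP; rewrite -subr_eq0; apply/eqP/eq0_small => e e0.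
have e2 : 0 < e / 2 by lra.
have [d0 d00 H0] := cdiff_continuous (cdiff_h _ U0) _ e2.
have [d1 d10 H1] := cdiff_continuous (cdiff_h _ U1) _ e2.
have [d d_gt0 []] := right_ev_ex _ (right_evI _ _
  (right_evI _ _ (right_evI _ _ (right_ev_U _ U0) (right_ev_U _ U1))
    (right_evI _ _ (right_ev_S (z + tau / 2%:R)) (right_ev_S (z + tau / 2%:R + 1))))
  (right_evI _ _ (right_ev_lt _ d00) (right_ev_lt _ d10))).
move=> [[V0 V1] [S0 S1]] [/andP[_ dd0] /andP[_ dd1]].
have h0 : h (z + d%:C) = w (z + tau / 2%:R + d%:C) * laurC p m (ez (z + d%:C)).
  by rewrite hE// (addrAC z) //.
have h1 : h (z + 1 + d%:C) = w (z + tau / 2%:R + 1 + d%:C) * laurC p m (ez (z + d%:C)).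
  have E : z + 1 + d%:C + tau / 2%:R = z + tau / 2%:R + 1 + d%:C by ring.
  rewrite hE// E//; congr (_ * laurC _ _ _).
  by rewrite addrAC ez1.
have h01 : h (z + 1 + d%:C) = h (z + d%:C).
  rewrite h0 h1; congr (_ * _); rewrite addrAC; apply: w1 => //.
  by rewrite addrAC.
have -> : h (z + 1) - h z = (h (z + d%:C) - h z) - (h (z + 1 + d%:C) - h (z + 1)).
  by rewrite h01; ring.
apply: le_trans (nrD _ _) _; rewrite nrN.
have := H0 (z + d%:C); have := H1 (z + 1 + d%:C).
rewrite !(addrC _ d%:C) !addrK nr_real gtr0_norm// => /(_ dd1) + /(_ dd0).
lra.
Qed.

Lemma h_rect y1 y2 : - (sg / 2) <= y1 -> y2 <= sg / 2 -> cdiff_rect h 0 1 y1 y2.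
Proof.
by move=> hy1 hy2 x y hx /andP[yy1 yy2]; apply/cdiff_h/strip_in_U => //; lra.
Qed.

Lemma ccseg_h y : - (sg / 2) <= y <= sg / 2 -> ccseg 0 1 (fun x => h (x +i* y)).
Proof.
by move=> hy x hx; apply: ccont_hor; apply/cdiff_h/strip_in_U.
Qed.

Lemma ccseg_w : ccseg 0 1 (fun x => w x%:C).
Proof. by move=> x _; apply: (ccont_hor _ 0); apply: cdiff_w; exact: realS. Qed.

(** Each monomial times h is holomorphic and 1-periodic on the closed strip. *)
Lemma strip_shift s y1 y2 : - (sg / 2) <= y1 <= sg / 2 ->
  - (sg / 2) <= y2 <= sg / 2 ->
  cint 0 1 (fun x => lfun s (ez (x +i* y1)) * h (x +i* y1)) =
  cint 0 1 (fun x => lfun s (ez (x +i* y2)) * h (x +i* y2)).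
Proof.
wlog y12 : y1 y2 / y1 < y2.
  move=> H h1 h2; have [y12|y21|->//] := ltgtP y1 y2; first exact: H.
  by apply/esym; exact: H.
move=> h1 h2; pose F (x : R[i] * int) (z : R[i]) := ez z ^ x.2 * h z.
have Fd x : cdiff_rect (F x) 0 1 y1 y2.
  move=> a b ha hb; apply: cdiffM; first exact: cdiff_ezXz.
  by apply: h_rect (ha) (hb); lra.
have Fc x y : y1 <= y <= y2 -> ccseg 0 1 (fun a => x.1 * F x (a +i* y)).
  move=> hy a ha; apply: ccontM; first exact: ccont_cst.
  by apply: ccont_hor; exact: Fd.
have E y : y1 <= y <= y2 -> cint 0 1 (fun x => lfun s (ez (x +i* y)) * h (x +i* y)) =
    \sum_(x <- s) x.1 * cint 0 1 (fun a => F x (a +i* y)).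
  move=> hy; transitivity (\sum_(x <- s) cint 0 1 (fun a => x.1 * F x (a +i* y))).
    rewrite -cint_sum; last by move=> x; exact: Fc.
    apply: eq_cint => x _; rewrite /lfun mulr_suml; apply: eq_bigr => k _.
    by rewrite mulrA.
  apply: eq_bigr => x _; apply: cintZ => a ha.
  by apply: ccont_hor; exact: Fd.
rewrite !E ?lexx ?(ltW y12)//; apply: eq_bigr => x _; congr (_ * _).
apply: periodic_strip_shift => // y hy; rewrite /F h_periodic; last lra.
have -> // : ez (1 +i* y) = ez (0 +i* y).
rewrite -[RHS]ez1; apply: congr1.
by apply/eqP; rewrite eq_complex /=; apply/andP; split; apply/eqP; ring.
Qed.

Lemma h_bottom x : 0 <= x <= 1 -> h (x +i* (- (sg / 2))) =
  w x%:C * laurC p m ((q%:C)^-1 * ez x%:C).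
Proof.
move=> hx; have E : x +i* (- (sg / 2)) + tau / 2%:R = x%:C.
  by rewrite tau2E; apply/eqP; rewrite eq_complex /=; apply/andP; split;
    apply/eqP; ring.
rewrite hE; first by rewrite E ez_bottom.
- by apply: strip_in_U => //; have : 0 < sg by []; lra.
- by rewrite E; exact: realS.
Qed.

(** The left side is the integral of s h along the lower edge of the strip, where the argument of w
    is real and that of P is e(x)/q. *)
Lemma contour_shift s :
  cint 0 1 (fun x => lfun s ((q%:C)^-1 * ez x%:C) *
    (w x%:C * laurC p m ((q%:C)^-1 * ez x%:C))) =
  cint 0 1 (fun x => lfun s (ez x%:C) * h x%:C).
Proof.
have sg0 : 0 < sg by [].
have b1 : - (sg / 2) <= - (sg / 2) <= sg / 2 by lra.
have b2 : - (sg / 2) <= 0 <= sg / 2 by lra.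
apply: etrans (strip_shift s _ _ b1 b2).
apply: eq_cint => x hx; rewrite (h_bottom x hx) ez_bottom.
reflexivity.
Qed.

(* A line on which [h] vanishes kills all Fourier coefficients of [h] on all the
   other lines; this replaces the identity theorem. *)
Lemma h_vanish y0 : - (sg / 2) <= y0 <= sg / 2 ->
  (forall x, 0 <= x <= 1 -> h (x +i* y0) = 0) ->
  forall x y, 0 <= x <= 1 -> - (sg / 2) <= y <= sg / 2 -> h (x +i* y) = 0.
Proof.
move=> hy0 h0 x y hx hy.
apply: (fun H => fourier_eq0 _ (ccseg_h y hy) H x hx) => s.
(* The rescaling undoes the modulus of e(x + iy), so that s' on this line takes the values of s on
   the unit circle. *)
pose s' := lscale (ez (0 +i* y))^-1 s.
rewrite -[RHS](_ : cint 0 1 (fun x => lfun s' (ez (x +i* y)) * h (x +i* y)) = 0).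
  apply: eq_cint => a _; rewrite lfun_lscale -ezN -ezD.
  apply: (congr1 (fun z => lfun s (ez z) * _)).
  by apply/eqP; rewrite eq_complex /=; apply/andP; split; apply/eqP; ring.
rewrite (strip_shift s' y y0)// -[RHS](mul0r (1 - 0)%:C) -cint_cst//.
by apply: eq_cint => a ha; rewrite h0// mulr0.
Qed.

(** Transport of vanishing between right germs; quasi-periodicity is only available off S, hence for
    small d > 0. *)
Definition wzero (z z' : R[i]) :=
  right_ev (fun d => w (z + d%:C) = 0 -> w (z' + d%:C) = 0).

Lemma wzero_trans z2 z1 z3 : wzero z1 z2 -> wzero z2 z3 -> wzero z1 z3.
Proof.
move=> /right_evI H /H; apply: right_evS => d [h1 h2] /h1 /h2 //.
Qed.

Lemma wzero_step (k b : R[i]) : k != 0 ->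
  (forall z, ~ S z -> ~ S (z + b) -> w (z + b) = k * w z) ->
  forall z, wzero z (z + b) /\ wzero (z + b) z.
Proof.
move=> k0 wb z; have E : right_ev (fun d => w (z + b + d%:C) = k * w (z + d%:C)).
  have := right_evI _ _ (right_ev_S z) (right_ev_S (z + b)).
  by apply: right_evS => d [s1 s2]; rewrite addrAC wb// addrAC.
split; apply: right_evS E => d -> //; first by move=> ->; rewrite mulr0.
by move=> /eqP; rewrite mulf_eq0 (negbTE k0) => /eqP.
Qed.

Lemma wzero_shift (k b : R[i]) : k != 0 ->
  (forall z, ~ S z -> ~ S (z + b) -> w (z + b) = k * w z) ->
  forall z (n : int), wzero z (z + n%:~R * b).
Proof.
move=> k0 wb z; have st := wzero_step k b k0 wb.
elim/int_ind => [|n IH|n IH].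
- by rewrite mul0r addr0; exists 1.
- have -> : z + n.+1%:~R * b = z + n%:~R * b + b.
    by rewrite -addn1 PoszD intrD mulrDl mul1r addrA.
  by apply: wzero_trans IH _; have [] := st (z + n%:~R * b).
- have -> : z + (- n.+1%:Z)%:~R * b = z + (- n%:Z)%:~R * b - b.
    by rewrite -addn1 PoszD opprD intrD mulrDl mulN1r addrA.
  apply: wzero_trans IH _; have [_] := st (z + (- n%:Z)%:~R * b - b).
  by rewrite subrK.
Qed.

(** Otherwise h vanishes on the whole strip. Dividing by P off its zeros, w vanishes on the right
    germ at each point of a fundamental rectangle, hence by quasi-periodicity near a point where it
    is continuous and nonzero. *)
Lemma h_line_neq0 y0 : - (sg / 2) <= y0 <= sg / 2 ->
  exists2 x, 0 <= x <= 1 & h (x +i* y0) != 0.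
Proof.
move=> hy0; have [//|H] := pselect (exists2 x, 0 <= x <= 1 & h (x +i* y0) != 0).
have {H} h0 x y : 0 <= x <= 1 -> - (sg / 2) <= y <= sg / 2 -> h (x +i* y) = 0.
  apply: (h_vanish y0 hy0) => x' hx'; apply/eqP/negPn/negP => hx0.
  by apply: H; exists x'.
exfalso; have [z0 [Sz0 wz0]] := w_neq0.
have sg0 : 0 < sg by [].
pose x0 := complex.Re z0; pose y1 := complex.Im z0.
(* The translates by 1 and tau bring z0 into 0 <= x < 1, 0 <= y < sg; the strict bound x < 1 leaves
   room for z + d. *)
pose j := Num.floor x0; pose k := Num.floor (y1 / sg).
pose x := x0 - j%:~R; pose y := y1 - k%:~R * sg.
have hx : 0 <= x < 1.
  by rewrite subr_ge0 floor_le ltrBlDl -intrD1 floorD1_gt.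
have hy : 0 <= y < sg.
  rewrite subr_ge0 -ler_pdivlMr// floor_le ltrBlDl -[X in _ + X]mul1r -mulrDl.
  by rewrite -ltr_pdivrMr// -intrD1 floorD1_gt.
pose z : R[i] := x +i* y.
have zz0 : z + j%:~R * 1 + k%:~R * tau = z0.
  rewrite mulr1 tauE -!(rmorph_int (real_complex R)) /z /x /y /x0 /y1; case: (z0) => a b.
  by apply/eqP; rewrite eq_complex /=; apply/andP; split; apply/eqP; ring.
have w1' z' : ~ S z' -> ~ S (z' + 1) -> w (z' + 1) = 1 * w z'.
  by rewrite mul1r; exact: w1.
have zw : wzero z z0.
  rewrite -zz0; apply: wzero_trans (wzero_shift t tau t0 wtau _ _).
  exact: wzero_shift (oner_neq0 _) w1' _ _.
(* Lowering by tau/2 places the point in the strip where h is defined. *)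
pose z2 : R[i] := x +i* (y - sg / 2).
have z2E : z2 + tau / 2%:R = z.
  by rewrite tau2E; apply/eqP; rewrite eq_complex /=; apply/andP; split;
    apply/eqP; ring.
have x1 : 0 < 1 - x by lra.
have wz : right_ev (fun d => w (z + d%:C) = 0).
  have := right_evI _ _ (right_evI _ _ (right_ev_S z) (right_ev_lt _ x1))
    (right_ev_poly p z2 p0).
  apply: right_evS => d [[Sd hd] pd].
  have zd : z2 + d%:C = (x + d) +i* (y - sg / 2).
    by apply/eqP; rewrite eq_complex /=; apply/andP; split; apply/eqP; ring.
  have Ud : U (z2 + d%:C) by rewrite zd; apply: strip_in_U; lra.
  have E : z2 + d%:C + tau / 2%:R = z + d%:C by rewrite addrAC z2E.
  have := hE _ Ud; rewrite E => /(_ Sd).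
  rewrite {1}zd h0; [|lra|lra].
  move=> /esym/eqP; rewrite /laurC !mulf_eq0 (negbTE pd) orbF.
  by rewrite (negbTE (expfz_neq0 _ (ez_neq0 _))) orbF => /eqP.
have N0 : 0 < nr (w z0) by rewrite lt_neqAle eq_sym nr_eq0 wz0 nr_ge0.
have [r r0 Hr] := cdiff_continuous (cdiff_w _ Sz0) _ N0.
have [d d0 [[wd0 /(_ wd0) wd] /andP[_ dr]]] := right_ev_ex _
  (right_evI _ _ (right_evI _ _ wz zw) (right_ev_lt _ r0)).
have := Hr (z0 + d%:C); rewrite addrC addKr nr_real gtr0_norm// => /(_ dr).
by rewrite wd sub0r nrN ltxx.
Qed.

(** On the lower edge h is w(x) times a value of P, so a nonzero value of h there gives one of w. *)
Lemma w_real_neq0 : exists2 x, 0 <= x <= 1 & w x%:C != 0.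
Proof.
have sg0 : 0 < sg by [].
have [|x hx] := h_line_neq0 (- (sg / 2)); first by lra.
rewrite h_bottom// mulf_eq0 negb_or => /andP[wx _]; by exists x.
Qed.

Lemma h_real_neq0 : exists2 x, 0 <= x <= 1 & h x%:C != 0.
Proof. by have sg0 : 0 < sg by []; apply: (h_line_neq0 0); lra. Qed.

End Strip.


(** * The trace as an integral *)

(** Rewrites the degree 1 integrand as G(z/k) P(z/k), where G(z) is s(kz) times the conjugate series
    at z/k; on the unit circle, for k = q, G is |s(qz)|^2. *)
Lemma lfun_degree1 {R : realType} (k z : R[i]) (p : {poly R[i]}) m s :
  k != 0 -> z != 0 ->
  lfun (lmul (lmul s (lscale (k ^+ 2)^-1 (lconj s))) (lpoly p m k^-1)) z =
  lfun (lmul (lscale k s) (lscale k^-1 (lconj s))) (k^-1 * z) *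
    laurC p m (k^-1 * z).
Proof.
move=> k0 z0; have z1 : k^-1 * z != 0 by rewrite mulf_neq0 ?invr_neq0.
rewrite (lfun_lmul (lmul _ _) _ _ z0) (lfun_lmul s _ _ z0).
rewrite (lfun_lmul (lscale k s) _ _ z1).
rewrite (lfun_lpoly _ _ _ _ z1).
rewrite !lfun_lscale.
have -> : k * (k^-1 * z) = z by rewrite mulVKf.
have -> // : k^-1 * (k^-1 * z) = (k ^+ 2)^-1 * z.
by rewrite mulrA -expr2 exprVn.
Qed.

Section TraceIntegral.
Context {R : realType} {q : R} {tau : R[i]} {p : {poly R[i]}} {m : int}.
Context {w h : R[i] -> R[i]} {S : set R[i]} {U : set (R[i])^o} {e : R[i]}.
Context (q01 : 0 < q < 1) (Re_tau : complex.Re tau = 0)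
  (Im_tau : 0 < complex.Im tau) (q_tau : q%:C = cexp (pi%:C * iC * tau)).
Context (p0 : p != 0) (mero : meromorphic w S).
Context (w_neq0 : exists z, ~ S z /\ w z != 0) (e0 : e != 0).
Context (roots : forall z : R[i], root p z -> q%:C < `|z| < (q%:C)^-1).
Context (w1 : forall z, ~ S z -> ~ S (z + 1) -> w (z + 1) = w z).
Context (wtau : forall z, ~ S z -> ~ S (z + tau) -> w (z + tau) = e ^+ 2 * w z).
Context (openU : open U) (parU : parallelogram tau `<=` U).
Context (holo_h : forall z : R[i], U z -> holo_at h z).
Context (hE : forall z : R[i], U z -> ~ S (z + tau / 2%:R) ->
     h z = w (z + tau / 2%:R) * laurC p m (ez z)).
Context (realS : forall x : R, ~ S x%:C).
Context {A : algType R[i]} {u v Z Zi : A} {g : A -> A} {rho : {rmorphism A -> A}}.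
Context {T : A -> R[i]} (AP : is_AP q p m u v Z Zi).
Context (gZ : forall k a, g (k *: a) = k *: g a).
Context (g_u : g u = e ^+ 2 *: u) (g_v : g v = e ^- 2 *: v).
Context (rhoZ : forall (k : R[i]) a, rho (k *: a) = conjc k *: rho a).
Context (rho_u : rho u = e^-1 *: v) (rho_v : rho v = e *: u).
Context (rho_Z : rho Z = Zi) (rho_Zi : rho Zi = Z).
Context (TT : twisted_trace g T).
Context (T_graded : forall i a, i != 0 -> in_Ai q Z Zi i a -> T a = 0).
Context (T_int : forall (r : {poly R[i]}) (k : int), T (laurA Z Zi r k 1) =
  cint01 (fun x : R => laurC r k (ez x%:C) * w x%:C)).
Local Notation lev := (lev Z Zi).

Let q0 : 0 < q. Proof. by case/andP: q01. Qed.

Let qC0 : q%:C != 0 :> R[i].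
Proof. by rewrite (inj_eq (@complexI R) q 0) gt_eqF. Qed.

Let ZZi : Z * Zi = 1. Proof. by case: AP => -[]. Qed.
Let ZiZ : Zi * Z = 1. Proof. by case: AP => -[]. Qed.

Let w_cont : ccseg 0 1 (fun x => w x%:C).
Proof. exact: (ccseg_w mero realS). Qed.

Let h_cont : ccseg 0 1 (fun x => h x%:C).
Proof.
by apply: (ccseg_h Re_tau Im_tau parU holo_h 0); move: Im_tau; lra.
Qed.

Let eh_cont : ccseg 0 1 (fun x => e^-1 * h x%:C).
Proof.
by move=> x hx; apply: ccontM; [exact: ccont_cst|exact: h_cont].
Qed.

Lemma trace_Zpow k : T (Zpow Z Zi k) = cint 0 1 (fun x => ez x%:C ^ k * w x%:C).
Proof.
have -> : Zpow Z Zi k = laurA Z Zi 1 k 1.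
  by rewrite /laurA size_poly1 big_ord1 coef1 exp1rz mulr1 scale1r add0r.
rewrite T_int -[LHS]/(cint 0 1 _); apply: eq_cint => x _.
by rewrite /laurC hornerC mulr1.
Qed.

Lemma trace_lev s : T (lev s) = cint 0 1 (fun x => lfun s (ez x%:C) * w x%:C).
Proof.
have Ec k : ccseg 0 1 (fun x => ez x%:C ^ k * w x%:C).
  move=> x hx; apply: ccontM; last exact: w_cont.
  by apply: ccontXz (ez_neq0 _) _; exact: ccont_ez0.
transitivity (cint 0 1 (fun x => \sum_(i <- s) i.1 * (ez x%:C ^ i.2 * w x%:C))).
  rewrite cint_sum; last first.
    by move=> i x hx; apply: ccontM; [exact: ccont_cst|exact: Ec].
  rewrite /lev (trace_sum TT); apply: eq_bigr => i _.
  by rewrite (traceZ TT) trace_Zpow -cintZ.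
apply: eq_cint => x _; rewrite /lfun mulr_suml; apply: eq_bigr => i _.
by rewrite mulrA.
Qed.

Let conj_invez x : conjc (ez x%:C)^-1 = ez x%:C :> R[i].
Proof. by rewrite -ezN -rmorphN ez_conj rmorphN ezN invrK. Qed.

Lemma trace_degree0 s :
  T (lev s * rho (lev s)) = sqint 1 (fun x => w x%:C) s.
Proof.
rewrite (rho_lev rhoZ rho_Z rho_Zi) -(levM ZZi ZiZ) trace_lev.
apply: eq_cint => x _.
by rewrite (lfun_lmul _ _ _ (ez_neq0 _)) lfun_lconj conj_invez mul1r.
Qed.

(** Moving u to the right past the conjugate series and using uv = P(q^{-1}Z) gives a degree 0
    element; the contour shift then replaces z/q by z, which makes the integrand a square
    modulus. *)
Lemma trace_degree1 s :
  T (lev s * u * rho (lev s * u)) = sqint q%:C (fun x => e^-1 * h x%:C) s.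
Proof.
have qi : q%:C^-1 != 0 :> R[i] by rewrite invr_neq0.
have q2 : (q%:C ^+ 2)^-1 != 0 :> R[i] by rewrite invr_neq0 ?expf_neq0.
pose G := lmul (lscale q%:C s) (lscale (q%:C)^-1 (lconj s)).
have -> : T (lev s * u * rho (lev s * u)) = e^-1 * T (lev
    (lmul (lmul s (lscale (q%:C ^+ 2)^-1 (lconj s))) (lpoly p m (q%:C)^-1))).
  rewrite rmorphM rho_u (rho_lev rhoZ rho_Z rho_Zi) -!scalerAr (traceZ TT).
  rewrite !(levM ZZi ZiZ) -(uvE AP) -(mulrA (lev s) u) (mulrA u).
  by rewrite (skew_lev ZZi ZiZ _ _ _ q2 (uZ q0 AP)) !mulrA.
rewrite trace_lev.
have -> : cint 0 1 (fun x => lfun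
    (lmul (lmul s (lscale (q%:C ^+ 2)^-1 (lconj s))) (lpoly p m (q%:C)^-1))
      (ez x%:C) * w x%:C) = cint 0 1 (fun x => lfun G ((q%:C)^-1 * ez x%:C) *
    (w x%:C * laurC p m ((q%:C)^-1 * ez x%:C))).
  apply: eq_cint => x _.
  by rewrite (lfun_degree1 _ _ _ _ _ qC0 (ez_neq0 _)) -mulrA (mulrC (laurC _ _ _)).
rewrite (contour_shift Re_tau Im_tau q_tau mero w1 openU parU holo_h hE realS).
rewrite -cintZ; last first.
  move=> x hx; apply: ccontM; last exact: h_cont.
  by apply: ccont_lfun (ez_neq0 _) _; exact: ccont_ez0.
apply: eq_cint => x _.
rewrite (lfun_lmul _ _ _ (ez_neq0 _)) !lfun_lscale lfun_lconj invfM invrK.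
have -> : conjc (q%:C * (ez x%:C)^-1) = q%:C * ez x%:C :> R[i].
  exact: etrans (rmorphM (@conjc R) _ _) (congr2 *%R (conjc_real q) (conj_invez x)).
by rewrite mulrCA.
Qed.

Lemma laurC_neq0 z : z != 0 -> (nr z <= q) || (q^-1 <= nr z) -> laurC p m z != 0.
Proof.
move=> z0 hz; rewrite /laurC mulf_neq0 ?expfz_neq0//; apply/negP => /roots.
rewrite -fmorphV nrE !ltcR => /andP[h1 h2].
by move: hz; rewrite leNgt h1 leNgt h2.
Qed.

(** If the product is zero, so is its norm, and its function vanishes on an arc where w is nonzero.
    There the factor P(al kap z) has no zero, so s vanishes on the arc and the element is zero. *)
Lemma lev_factor_inj (kap al : R[i]) s : kap != 0 -> al != 0 ->
  (nr (al * kap) <= q) || (q^-1 <= nr (al * kap)) ->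
  (forall x, 0 <= x <= 1 -> 0 <= w x%:C) ->
  lev (lmul s (lscale kap (lpoly p m al))) = 0 -> lev s = 0.
Proof.
move=> k0 a0 hn wge0 s0; set s' := lmul _ _ in s0.
have wx := w_real_neq0 Re_tau Im_tau q_tau p0 mero w_neq0 (expf_neq0 2 e0) w1 wtau
  openU parU holo_h hE realS.
have [a [b [ab ab2 H]]] := sqint_vanish _ w_cont wge0 wx.
have I0 : sqint 1 (fun x => w x%:C) s' = 0.
  by rewrite -trace_degree0 s0 mul0r (trace0 TT).
apply: (lev_vanish 1 s a b ZZi ZiZ (oner_neq0 _) ab ab2) => x hx.
have := H 1 s' (oner_neq0 _) I0 x hx; rewrite mul1r.
have z1 : kap * ez x%:C != 0 by rewrite mulf_neq0 ?ez_neq0.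
have z2 : al * (kap * ez x%:C) != 0 by rewrite mulf_neq0.
rewrite (lfun_lmul _ _ _ (ez_neq0 _)) lfun_lscale (lfun_lpoly _ _ _ _ z2) => /eqP.
rewrite mulf_eq0 (negbTE (laurC_neq0 _ z2 _)) ?orbF; first by move/eqP.
by rewrite mulrA nrM nr_ez_real mulr1.
Qed.

Lemma positive_trace_iff : positive_trace rho T <->
  (forall x : R, 0 <= x <= 1 -> 0 <= w x%:C /\ 0 <= e^-1 * h x%:C).
Proof.
have T_ge0 a : positive_trace rho T -> 0 <= T (a * rho a).
  move=> Tpos; have [->|a0] := eqVneq a 0; last exact/ltW/Tpos.
  by rewrite mul0r (trace0 TT).
split=> [Tpos x hx|pos].
  split.
    apply: (fun H => sqint_ge0 _ w_cont H x hx) => s.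
    by rewrite -trace_degree0 T_ge0.
  apply: (fun H => sqint_ge0 _ eh_cont H x hx) => s.
  (* Substituting z/q in s makes all square moduli on the unit circle available in degree 1. *)
  have -> : sqint 1 (fun x => e^-1 * h x%:C) s =
      sqint q%:C (fun x => e^-1 * h x%:C) (lscale (q%:C)^-1 s).
    apply: eq_cint => y _; rewrite lfun_lscale.
    have -> : (q%:C)^-1 * (q%:C * ez y%:C) = 1 * ez y%:C.
      by rewrite mulKf// mul1r.
    by [].
  by rewrite -trace_degree1 T_ge0.
have wge0 x : 0 <= x <= 1 -> 0 <= w x%:C by move=> /pos[].
have hge0 x : 0 <= x <= 1 -> 0 <= e^-1 * h x%:C by move=> /pos[].
have t0 := expf_neq0 2 e0.
have wx := w_real_neq0 Re_tau Im_tau q_tau p0 mero w_neq0 t0 w1 wtau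
  openU parU holo_h hE realS.
have hx : exists2 x, 0 <= x <= 1 & e^-1 * h x%:C != 0.
  have [x x01 hx] := h_real_neq0 Re_tau Im_tau p0 mero w_neq0 t0 w1 wtau
  openU parU holo_h hE.
  by exists x => //; rewrite mulf_neq0 ?invr_neq0.
(* A zero square integral against a nonnegative, not identically zero weight makes s vanish on an
   arc, so its element is zero. *)
have strict (lam : R[i]) f s : lam != 0 -> ccseg 0 1 f ->
    (forall x, 0 <= x <= 1 -> 0 <= f x) -> (exists2 x, 0 <= x <= 1 & f x != 0) ->
    lev s != 0 -> 0 < sqint lam f s.
  move=> l0 fc f0 fx; rewrite lt_def (sqint_pos_ge0 _ _ _ f0) andbT.
  apply: contraNneq => I0; have [a [b [ab ab2 H]]] := sqint_vanish _ fc f0 fx.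
  apply/eqP; apply: (lev_vanish lam s a b ZZi ZiZ l0 ab ab2) => x' hx'.
  exact: H.
have nq n : nr (q%:C ^+ n : R[i]) = q ^+ n.
  by rewrite -rmorphXn nr_real ger0_norm// exprn_ge0// ltW.
apply: (positive_of_low_degrees q0 AP rhoZ rho_u rho_v rho_Z rho_Zi e0 gZ g_u g_v TT T_graded).
- move=> n s; split; apply: lev_factor_inj => //.
  + by rewrite expf_neq0// invr_neq0// expf_neq0.
  + by rewrite invr_neq0.
  + apply/orP; right; rewrite -exprVn -exprM -exprS exprVn -rmorphXn -fmorphV.
    rewrite nr_real ger0_norm ?invr_ge0 ?exprn_ge0 ?(ltW q0)//.
    rewrite lef_pV2 ?posrE ?exprn_gt0//.
    by rewrite exprS ler_piMr ?(ltW q0)// exprn_ile1 ?(ltW q0)//; case/andP: q01 => _ /ltW.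
  + by rewrite !expf_neq0.
  + apply/orP; left; rewrite -exprM -exprS nq.
    by rewrite exprS ler_piMr ?(ltW q0)// exprn_ile1 ?(ltW q0)//; case/andP: q01 => _ /ltW.
- move=> s s0; rewrite trace_degree0; apply: strict => //; exact: oner_neq0.
- move=> s su0; rewrite trace_degree1; apply: strict => //.
  by apply: contra_neq su0 => ->; rewrite mul0r.
Qed.

End TraceIntegral.


Theorem theorem3p3
  (R : realType) (q : R) (tau : R[i]) (c : R)
  (p : {poly R[i]}) (m : int)
  (A : algType R[i]) (u v Z Zi : A)
  (g : {lrmorphism A -> A}) (rho : {rmorphism A -> A})
  (w : R[i] -> R[i]) (S : set R[i]) (U : set (R[i])^o) (h : R[i] -> R[i])
  (T : A -> R[i]) :
  (* q, tau *)
  0 < q < 1 -> complex.Re tau = 0 -> 0 < complex.Im tau ->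
  q%:C = cexp (pi%:C * iC * tau) ->
  (* c *)
  0 <= c < 1 ->
  (* P(z) = z^m p(z), p(0) <> 0, n = deg p > 0 nonzero roots, real on S^1 *)
  p`_0 != 0 -> (1 < size p)%N ->
  (forall z : R[i], `|z| = 1 -> laurC p m z \is Num.real) ->
  (* all nonzero roots of P in q < |z| < q^{-1} *)
  (forall z : R[i], root p z -> q%:C < `|z| < (q%:C)^-1) ->
  (* A = A_P *)
  is_AP q p m u v Z Zi ->
  (* g = g_t *)
  bijective g ->
  g u = cexp (2%:R * pi%:C * iC * c%:C) *: u ->
  g v = (cexp (2%:R * pi%:C * iC * c%:C))^-1 *: v ->
  g Z = Z -> g Zi = Zi ->
  (* rho antilinear automorphism *)
  bijective rho ->
  (forall (k : R[i]) (a : A), rho (k *: a) = k^* *: rho a) ->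
  rho u = cexp (- (pi%:C * iC * c%:C)) *: v ->
  rho v = cexp (pi%:C * iC * c%:C) *: u ->
  rho Z = Zi -> rho Zi = Z ->
  (* w : nonzero meromorphic, quasi-periodic *)
  meromorphic w S ->
  (exists z, ~ S z /\ w z != 0) ->
  (forall z, ~ S z -> ~ S (z + 1) -> w (z + 1) = w z) ->
  (forall z, ~ S z -> ~ S (z + tau) ->
     w (z + tau) = cexp (2%:R * pi%:C * iC * c%:C) * w z) ->
  (* w(x + tau/2) P(e^{2 pi i x}) holomorphic on the closed parallelogram,
     h being its holomorphic extension to an open neighbourhood U *)
  open U -> parallelogram tau `<=` U ->
  (forall z, U z -> holo_at h z) ->
  (forall z, U z -> ~ S (z + tau / 2%:R) ->
     h z = w (z + tau / 2%:R) * laurC p m (cexp (2%:R * pi%:C * iC * z))) ->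
  (* w holomorphic on R *)
  (forall x : R, ~ S x%:C) ->
  (* T *)
  twisted_trace g T ->
  (forall (i : int) (a : A), i != 0 -> in_Ai q Z Zi i a -> T a = 0) ->
  (forall (r : {poly R[i]}) (k : int),
     T (laurA Z Zi r k 1) =
     cint01 (fun x : R => laurC r k (cexp (2%:R * pi%:C * iC * x%:C)) * w x%:C)) ->
  (* conclusion *)
  positive_trace rho T <->
  (forall x : R, 0 <= x <= 1 ->
     0 <= w x%:C /\ 0 <= cexp (- (pi%:C * iC * c%:C)) * h x%:C).
Proof.
move=> q01 Re_tau Im_tau q_tau c01 p00 _ _ roots AP _ gu gv _ _ _ rhoZ rho_u rho_v
  rho_Z rho_Zi mero w_neq0 w1 wtau openU parU holo_h hE realS TT T_graded T_int.
(* A square root of t, the constant that occurs in [rho]. *)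
pose e : R[i] := cexp (pi%:C * iC * c%:C).
have te : cexp (2%:R * pi%:C * iC * c%:C) = e ^+ 2.
  by rewrite /e -cexpMn; congr cexp; ring.
have p0 : p != 0 by apply: contraNneq p00 => ->; rewrite coef0.
rewrite te in gu gv wtau; rewrite cexpN -/e; rewrite cexpN -/e in rho_u.
apply: (positive_trace_iff q01 Re_tau Im_tau q_tau p0 mero w_neq0 (cexp_neq0 _)
  roots w1 wtau openU parU holo_h hE realS AP _ gu gv rhoZ rho_u rho_v rho_Z rho_Zi
  TT T_graded T_int).
by move=> k a; rewrite linearZ.
Qed.
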